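(* Let $M\in\mathbb{Q}^{3\times3}$ have eigenvalues $\lambda,\overline{\lambda},\rho$ with $\lambda$ non-real and $\rho$ real, such that $\gamma=\lambda/|\lambda|$ is a root of unity, let $s\in\mathbb{Q}^3$, and let $T=\{x\in\mathbb{R}^3 : p(x)\sim0\}$ with $p\in\mathbb{Z}[x_1,x_2,x_3]$ and ${\sim}\in\{>,\ge\}$. Then there exist an integer $N\le 2^{\|\mathcal{I}_T\|^{c}}$, where $c$ is an absolute constant, and a set $X\subseteq\{0,1,\ldots,287\}$, computable from $M,s,p$, such that for all $n>N$: $M^ns\in T$ if and only if $n\bmod 288\in X$.
   Context: $\|\mathcal{I}_T\|=\|p\|+\|M\|+\|s\|$, where $\|M\|,\|s\|$ are bit lengths of the binary encodings of the rational entries and $\|p\|$ is the bit length of the list of integer coefficients of $p$ (including zeros). *)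

(* Defs.v *)
From mathcomp Require Import all_boot all_order all_algebra.
From mathcomp Require Import complex reals mpoly.

Set Implicit Arguments.
Unset Strict Implicit.
Unset Printing Implicit Defensive.

Import Order.TTheory GRing.Theory Num.Theory.

Local Open Scope ring_scope.

Variant sign_cond := SGt | SGe.

Definition mpeval (R : realType) (p : {mpoly int[3]}) (x : 'cV[R]_3) : R :=
  (map_mpoly intr p).@[fun i => x i 0].

Definition target (R : realType) (p : {mpoly int[3]}) (sim : sign_cond) :
    {pred 'cV[R]_3} :=
  [pred x | match sim with
            | SGt => 0 < mpeval p x
            | SGe => 0 <= mpeval p x
            end].

Arguments target : clear implicits.

Definition is_root_of_unity (F : fieldType) (z : F) : Prop :=
  exists2 k : nat, (0 < k)%N & k.-unity_root z.

(* Dense representation: all monomials of total degree at most deg p, zero     *)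
(* coefficients included; recall that msize p = deg p + 1 for p != 0.          *)
Definition coef_list (p : {mpoly int[3]}) : seq int :=
  let d := msize p in
  [seq p@_[multinom [tuple ijk.1.1; ijk.1.2; ijk.2]] |
     ijk <- [seq (ij, k) |
               ij <- [seq (i, j) | i <- iota 0 d, j <- iota 0 (d - i)],
               k <- iota 0 (d - ij.1 - ij.2)]].

(* One sign bit, then the binary digits of the absolute value ("0" for 0).     *)
Definition int_bits (z : int) : nat := (1 + (trunc_log 2 `|z|).+1)%N.

Definition rat_bits (q : rat) : nat := (int_bits (numq q) + int_bits (denq q))%N.

Definition mx_bits m n (A : 'M[rat]_(m, n)) : nat :=
  (\sum_i \sum_j rat_bits (A i j))%N.

Definition poly_bits (p : {mpoly int[3]}) : nat :=
  (\sum_(z <- coef_list p) int_bits z)%N.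

Definition instance_bits (M : 'M[rat]_3) (s : 'cV[rat]_3) (p : {mpoly int[3]}) :=
  (poly_bits p + mx_bits M + mx_bits s)%N.

(* Kleene's mu-recursive functions. Arities are not tracked: a function reads  *)
(* its arguments from a list, and an absent argument reads as 0.               *)
Inductive recfun :=
  | RZero
  | RSucc
  | RProj of nat
  | RComp of recfun & seq recfun
  | RPrec of recfun & recfun
  | RMu of recfun.

(* [computes f v y]: f is defined at the arguments v, with value y.            *)
(* In [RPrec f g] the recursion is on the first argument, and h lists its      *)
(* successive values: h 0 = f w and h (i+1) = g (i, h i, w).                   *)
Fixpoint computes (f : recfun) (v : seq nat) (y : nat) {struct f} : Prop :=
  match f with
  | RZero => y = 0
  | RSucc => y = (nth 0 v 0).+1
  | RProj i => y = nth 0 v i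
  | RComp f gs =>
      let fix all_compute gs ws {struct gs} : Prop :=
        match gs, ws with
        | [::], [::] => True
        | g :: gs, w :: ws => computes g v w /\ all_compute gs ws
        | _, _ => False
        end in
      exists ws, all_compute gs ws /\ computes f ws y
  | RPrec f g =>
      let n := nth 0 v 0 in
      let w := behead v in
      exists h : nat -> nat,
        [/\ computes f w (h 0),
            forall i, i < n -> computes g [:: i, h i & w] (h i.+1)
          & y = h n]
  | RMu f =>
      computes f (y :: v) 0 /\
      forall i, i < y -> exists k, computes f (i :: v) k.+1
  end%N.

Definition int_code (z : int) : nat :=
  match z with
  | Posz n => n.*2
  | Negz n => n.*2.+1
  end.

Definition mx_codes m n (A : 'M[rat]_(m, n)) : seq nat :=
  flatten [seq [:: int_code (numq (A ij.1 ij.2)); int_code (denq (A ij.1 ij.2))]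
          | ij <- [seq (i, j) | i <- enum 'I_m, j <- enum 'I_n]].

(* A tuple of 18 + 6 + 1 + 1 natural numbers; the last one is the code of the  *)
(* whole list of coefficients.                                                 *)
Definition instance_codes (M : 'M[rat]_3) (s : 'cV[rat]_3)
    (p : {mpoly int[3]}) : seq nat :=
  mx_codes M ++ mx_codes s ++
  [:: msize p; CodeSeq.code [seq int_code z | z <- coef_list p]].

Definition set_code n (X : {set 'I_n}) : nat := (\sum_(i in X) 2 ^ i)%N.

(* Main.v *)
Require Import Defs.
From mathcomp Require Import all_boot all_order all_algebra all_field.
From mathcomp Require Import complex reals mpoly.
From mathcomp Require Import ring zify.

(** Scaling by a common denominator, one may assume that M is an integer matrix.
    If rho is rational, then w = lam / conj lam is a root of unity whose trace
    w + 1/w is a rational algebraic integer in [-2, 2], so w^12 = 1; otherwise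
    reducing lam^k = (conj lam)^k modulo the characteristic polynomial shows that
    this polynomial is X^3 - t. In both cases lam^288 = (conj lam)^288 and rho^288
    are natural numbers, so M^288, which is diagonalizable, is annihilated by
    (X - a)(X - b) for two distinct natural numbers a and b. Hence along each
    residue class modulo 288 the homogenized value of p on the orbit is, up to a
    positive factor, a sum of terms c h^m with c an integer and h a natural number.
    The largest base with nonzero total coefficient dominates as soon as m exceeds
    (max h) * (sum |c|), by Bernoulli's inequality, and this threshold is singly
    exponential in the size of the instance. The residue set is computed by
    evaluating the sign once in each class, at an index beyond the threshold. *)

Set Implicit Arguments.
Unset Strict Implicit.
Unset Printing Implicit Defensive.

Import Order.TTheory GRing.Theory Num.Theory.

Local Open Scope ring_scope.

(** * Eigenvalues *)

Lemma integral_ratr_int (F : numFieldType) (x : rat) :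
  integralOver (intr : int -> F) (ratr x) -> x \is a Num.int.
Proof.
move=> [p p_monic px].
have ratr_intr (L : numFieldType) : map_poly ratr (map_poly intr p) =
    map_poly intr p :> {poly L}.
  by rewrite -map_poly_comp; apply: eq_map_poly => z /=; rewrite ratr_int.
have {}px : root (map_poly intr p) x by rewrite -ratr_intr fmorph_root in px.
have xAint : (ratr x : algC) \in Aint.
  apply: (@root_monic_Aint (map_poly intr p)).
  - by rewrite -ratr_intr fmorph_root.
  - exact: monic_map.
  - by apply/polyOverP => i; rewrite coef_map rpred_int.
have /intrP[m xm] := Cint_rat_Aint (Crat_rat x) xAint.
by apply/intrP; exists m; apply: (@fmorph_inj _ algC ratr); rewrite /= ratr_int.
Qed.

Lemma integral_unity_root (F : fieldType) (w : F) k :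
  (0 < k)%N -> w ^+ k = 1 -> integralOver (intr : int -> F) w.
Proof.
move=> k0 wk; exists ('X^k - 1); first exact: monicXnsubC.
by rewrite rmorphB rmorph1 /= map_polyXn /root !hornerE wk subrr.
Qed.

Lemma unity_root_rational_trace (F : numFieldType) (w : F) (x : rat) k :
  (0 < k)%N -> w ^+ k = 1 -> w + w^-1 = ratr x -> w ^+ 12 = 1.
Proof.
move=> k0 wk wx.
have norm_w : `|w| = 1.
  by apply/eqP; rewrite -(@pexpr_eq1 _ _ k) // -normrX wk normr1.
have w0 : w != 0 by rewrite -normr_eq0 norm_w oner_neq0.
have /intrP[y xy] : x \is a Num.int.
  apply: (@integral_ratr_int F); rewrite -wx; apply: integral_add.
    exact: integral_unity_root wk.
  by apply: (@integral_unity_root _ _ k); rewrite // exprVn wk invr1.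
rewrite xy ratr_int in wx.
have norm_y : `|y| <= 2.
  rewrite -(ler_int F) intr_norm -wx (le_trans (ler_normD _ _)) //.
  by rewrite normfV norm_w invr1.
have trace_root : (w + w^-1) * ((w + w^-1) ^+ 2 - 1) * ((w + w^-1) ^+ 2 - 4) = 0.
  rewrite wx; have: y = -2 \/ y = -1 \/ y = 0 \/ y = 1 \/ y = 2 by lia.
  by move=> [|[|[|[|]]]] ->; ring.
(* The square of a cyclotomic polynomial, divided by a power of X, is a
   polynomial in X + 1/X. *)
have cyclotomic12 : (w ^+ 12 - 1) ^+ 2 =
    (w + w^-1) * ((w + w^-1) ^+ 2 - 1) * ((w + w^-1) ^+ 2 - 4) *
    (w ^+ 12 * (w + w^-1) * ((w + w^-1) ^+ 2 - 1) * ((w + w^-1) ^+ 2 - 3) ^+ 2).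
  by field.
by apply/eqP; rewrite -subr_eq0 -sqrf_eq0 cyclotomic12 trace_root mul0r.
Qed.

Definition is_ratr (F : unitRingType) (z : F) := exists x : rat, z = ratr x.

Lemma integral_ratr_pow_nat (F : numFieldType) (z : F) k :
  integralOver (intr : int -> F) z -> is_ratr z ->
  exists a : nat, z ^+ k.*2 = a%:R.
Proof.
move=> z_integral [x zE]; rewrite zE in z_integral *.
have /intrP[y ->] := integral_ratr_int z_integral; exists (`|y| ^ k.*2)%N.
rewrite ratr_int natrX natr_absz intr_norm -mul2n !exprM real_normK //.
exact: realz.
Qed.

Lemma root_exp_modp (F L : fieldType) (f : {rmorphism F -> L}) (p : {poly F})
    (z : L) k :
  root (map_poly f p) z -> z ^+ k = (map_poly f ('X^k %% p)).[z].
Proof.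
move=> /eqP pz; transitivity (map_poly f 'X^k).[z].
  by rewrite map_polyXn hornerXn.
by rewrite {1}(divp_eq 'X^k p) rmorphD rmorphM /= !hornerE pz mulr0 add0r.
Qed.

Lemma horner_size3 (R : nzRingType) (p : {poly R}) (x : R) :
  (size p <= 3)%N -> p.[x] = p`_0 + p`_1 * x + p`_2 * x ^+ 2.
Proof.
by move=> /horner_coef_wide ->; rewrite !big_ord_recr big_ord0 /= add0r expr0 mulr1.
Qed.

Lemma rational_sum_prod_pow12 (F : numFieldType) (x y : F) k :
  (0 < k)%N -> x ^+ k = y ^+ k -> is_ratr (x + y) -> is_ratr (x * y) ->
  x ^+ 12 = y ^+ 12.
Proof.
move=> k_gt0 xyk [u sumE] [v prodE].
have [y0|y0] := eqVneq y 0.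
  move: xyk; rewrite y0 expr0n gtn_eqF // => /eqP.
  by rewrite expf_eq0 k_gt0 => /eqP ->.
have x0 : x != 0.
  by apply: contra_eq_neq xyk => ->; rewrite expr0n gtn_eqF // eq_sym expf_neq0.
have ratio_trace : x / y + (x / y)^-1 = ratr ((u ^+ 2 - 2 * v) / v).
  rewrite fmorph_div rmorphB rmorphXn rmorphM /= -sumE -prodE rmorph_nat.
  by field; apply/andP.
have ratio_pow : (x / y) ^+ k = 1 by rewrite expr_div_n xyk divff ?expf_neq0.
have := unity_root_rational_trace k_gt0 ratio_pow ratio_trace.
by rewrite expr_div_n => /divr1_eq.
Qed.

Section ConjugatePairCubic.

Variables (C : numClosedFieldType) (lam rho : C).

Hypotheses (lam_nonreal : lam \isn't Num.real) (rho_real : rho \is Num.real).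

Local Notation roots := [:: lam; lam^*; rho].

Lemma uniq_conj_pair_real : uniq roots.
Proof.
rewrite /= !inE negb_or andbT -andbA; apply/and3P; split.
- by rewrite eq_sym -CrealE.
- by apply: contraNneq lam_nonreal => ->.
- by apply: contraNneq lam_nonreal => lamJ; rewrite -(conjCK lam) lamJ conj_Creal.
Qed.

Lemma coef_conj_pair_cubic (p : {poly C}) :
  p = \prod_(z <- roots) ('X - z%:P) ->
  [/\ p`_2 = - (lam + lam^* + rho), p`_1 = lam * lam^* + (lam + lam^* ) * rho
    & p`_0 = - (lam * lam^* * rho)].
Proof.
move=> ->; have -> : \prod_(z <- roots) ('X - z%:P) =
    'X^3 - (lam + lam^* + rho)%:P * 'X^2 +
    (lam * lam^* + (lam + lam^* ) * rho)%:P * 'X - (lam * lam^* * rho)%:P.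
  by rewrite !big_cons big_nil !(rmorphD, rmorphM) /=; ring.
by split; rewrite !(coefD, coefN, coefCM, coefXn, coefX, coefC) /=; ring.
Qed.

Section RationalCubic.

Variable p : {poly rat}.

Hypothesis p_split : map_poly ratr p = \prod_(z <- roots) ('X - z%:P).

Lemma conj_pair_cubic_monic_size : p \is monic /\ size p = 4%N.
Proof.
rewrite -(map_monic (ratr : {rmorphism rat -> C})) p_split monic_prod_XsubC.
by rewrite -(size_map_poly (ratr : {rmorphism rat -> C})) p_split size_prod_XsubC.
Qed.

(* Reducing X^k modulo the cubic, lam^k = (lam^* )^k forces either a rational
   value of lam + lam^* or a constant remainder. *)
Lemma conj_pair_cubic_same_norm k :
  (0 < k)%N -> lam ^+ k = lam^* ^+ k -> is_ratr rho \/ `|lam| = `|rho|.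
Proof.
move=> k_gt0 lam_pow; have [p_monic p_size] := conj_pair_cubic_monic_size.
pose r := 'X^k %% p.
have powE z : z \in roots ->
    z ^+ k = ratr r`_0 + ratr r`_1 * z + ratr r`_2 * z ^+ 2.
  move=> z_root; rewrite (@root_exp_modp _ _ ratr p); last first.
    by rewrite p_split root_prod_XsubC.
  rewrite -/r horner_size3 ?coef_map //.
  by rewrite size_map_poly -ltnS -p_size ltn_modp -size_poly_gt0 p_size.
have [lam_root lamJ_root rho_root] :
    [/\ lam \in roots, lam^* \in roots & rho \in roots].
  by rewrite !inE !eqxx !orbT.
have remainder_linear : ratr r`_2 * (lam + lam^* ) + ratr r`_1 = 0.
  have lam_sub0 : lam - lam^* != 0 by rewrite subr_eq0 eq_sym -CrealE.
  apply: (mulfI lam_sub0); rewrite mulr0.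
  transitivity (lam ^+ k - lam^* ^+ k); last by rewrite lam_pow subrr.
  by rewrite !powE //; ring.
have [r2|r2] := eqVneq r`_2 0.
  have r1 : ratr r`_1 = 0 :> C by rewrite -remainder_linear r2 rmorph0 mul0r add0r.
  right; apply: (@pexpIrn _ k); rewrite ?nnegrE ?normr_ge0 // -!normrX !powE //.
  by rewrite r1 r2 rmorph0 !mul0r.
left; exists (r`_1 / r`_2 - p`_2).
have [p2 _ _] := coef_conj_pair_cubic p_split.
rewrite coef_map /= in p2; rewrite rmorphB fmorph_div /= p2.
have -> : ratr r`_1 = - (ratr r`_2 * (lam + lam^* )).
  by apply/eqP; rewrite -addr_eq0 addrC remainder_linear.
by field; rewrite fmorph_eq0.
Qed.

Lemma same_norm_cubic_pure : `|lam| = `|rho| ->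
  is_ratr rho \/ exists x : rat, {in roots, forall z, z ^+ 3 = ratr x}.
Proof.
move=> norm_lam; have [p2 p1 _] := coef_conj_pair_cubic p_split.
rewrite !coef_map /= in p2 p1.
have rho2 : lam * lam^* = rho ^+ 2 by rewrite -normCK norm_lam real_normK.
have p12 : ratr p`_1 = - ratr p`_2 * rho by rewrite p1 p2 rho2; ring.
have [p20|p20] := eqVneq p`_2 0; last first.
  left; exists (- p`_1 / p`_2); rewrite fmorph_div rmorphN /= p12.
  by field; rewrite fmorph_eq0.
have [p_monic p_size] := conj_pair_cubic_monic_size.
right; exists (- p`_0) => z z_root.
have : root (map_poly ratr p) z by rewrite p_split root_prod_XsubC.
move=> /eqP; rewrite (horner_coef_wide (n := 4)) ?size_map_poly ?p_size //.
rewrite !big_ord_recr big_ord0 /= !coef_map /= p12 p20.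
have -> : p`_3 = 1 by rewrite -(monicP p_monic) lead_coefE p_size.
rewrite rmorph0 rmorph1 rmorphN /= => pz; apply/eqP; rewrite -addr_eq0.
by rewrite -[X in _ == X]pz; apply/eqP; ring.
Qed.

Lemma conj_pair_cubic_dichotomy k :
  (0 < k)%N -> lam ^+ k = lam^* ^+ k ->
  is_ratr rho \/ exists x : rat, {in roots, forall z, z ^+ 3 = ratr x}.
Proof.
move=> k_gt0 lam_pow.
have [rho_rat|] := conj_pair_cubic_same_norm k_gt0 lam_pow; first by left.
exact: same_norm_cubic_pure.
Qed.

Lemma conj_pair_cubic_ratr_sum_prod :
  is_ratr rho -> is_ratr (lam + lam^* ) /\ is_ratr (lam * lam^* ).
Proof.
move=> [x rhoE]; have [p2 p1 _] := coef_conj_pair_cubic p_split.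
rewrite !coef_map /= in p2 p1; pose u := - p`_2 - x.
have sumE : lam + lam^* = ratr u.
  by rewrite /u rmorphB rmorphN /= p2 rhoE; ring.
split; [by exists u | exists (p`_1 - u * x)].
by rewrite rmorphB rmorphM /= -sumE p1 rhoE; ring.
Qed.

End RationalCubic.

Lemma conj_pair_cubic_pow24 (p : {poly int}) k :
  p \is monic -> map_poly intr p = \prod_(z <- roots) ('X - z%:P) ->
  (0 < k)%N -> lam ^+ k = lam^* ^+ k ->
  exists a b : nat,
    [/\ lam ^+ 24 = a%:R, lam^* ^+ 24 = a%:R & rho ^+ 24 = b%:R].
Proof.
move=> p_monic p_split k_gt0 lam_pow.
have [q q_split] : exists q : {poly rat},
    map_poly ratr q = \prod_(z <- roots) ('X - z%:P).
  exists (map_poly intr p); rewrite -p_split -map_poly_comp.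
  by apply: eq_map_poly => y /=; apply: ratr_int.
have root_integral z : z \in roots -> integralOver (intr : int -> C) z.
  by move=> z_root; exists p; rewrite // p_split root_prod_XsubC.
have [rho_rat|[x cubeE]] := conj_pair_cubic_dichotomy q_split k_gt0 lam_pow.
- have [sum_rat prod_rat] := conj_pair_cubic_ratr_sum_prod q_split rho_rat.
  have [|a aE] := integral_ratr_pow_nat 6 _ prod_rat.
    by apply: integral_mul; apply: root_integral; rewrite !inE eqxx ?orbT.
  have [|b bE] := integral_ratr_pow_nat 12 _ rho_rat.
    by apply: root_integral; rewrite !inE eqxx !orbT.
  have lam12 := rational_sum_prod_pow12 k_gt0 lam_pow sum_rat prod_rat.
  exists a, b; rewrite -aE -bE exprMn.
  by split; rewrite // -[24%N]/(12 + 12)%N exprD ?lam12 // {1}lam12.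
- have cube_integral : integralOver (intr : int -> C) (ratr x).
    rewrite -(cubeE rho) ?inE ?eqxx ?orbT // !exprS mulr1.
    by do 2?apply: integral_mul; apply: root_integral; rewrite !inE eqxx !orbT.
  have [|a aE] := integral_ratr_pow_nat 4 cube_integral; first by exists x.
  exists a, a; rewrite -aE (_ : 24 = 3 * 8)%N // !exprM.
  by rewrite !cubeE ?inE ?eqxx ?orbT.
Qed.

Lemma conj_pair_cubic_pow_dvd24 (p : {poly int}) k j :
  p \is monic -> map_poly intr p = \prod_(z <- roots) ('X - z%:P) ->
  (0 < k)%N -> lam ^+ k = lam^* ^+ k -> (24 %| j)%N ->
  exists a b : nat,
    [/\ lam ^+ j = a%:R, lam^* ^+ j = a%:R & rho ^+ j = b%:R].
Proof.
move=> p_monic p_split k_gt0 lam_pow /dvdnP[d ->].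
have [a [b [lamE lamJE rhoE]]] := conj_pair_cubic_pow24 p_monic p_split k_gt0 lam_pow.
exists (a ^ d)%N, (b ^ d)%N; rewrite !(mulnC d) !exprM !natrX.
by rewrite lamE lamJE rhoE.
Qed.

End ConjugatePairCubic.

Lemma leq_abszD (x y : int) : (`|(x + y)%R| <= `|x| + `|y|)%N.
Proof. by lia. Qed.

Lemma leq_absz_sum (I : Type) (r : seq I) (P : pred I) (F : I -> int) :
  (`|(\sum_(i <- r | P i) F i)%R| <= \sum_(i <- r | P i) `|F i|)%N.
Proof.
elim/big_rec2: _ => // i x y _ le_yx.
by apply: leq_trans (leq_abszD _ _) _; rewrite leq_add2l.
Qed.

Lemma leq_wexp2r m n k : (m <= n)%N -> (m ^ k <= n ^ k)%N.
Proof. by case: k => // k mn; rewrite leq_exp2r. Qed.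

Definition mx_norm1 m n (A : 'M[int]_(m, n)) : nat :=
  (\sum_i \sum_j `|A i j|)%N.

Lemma leq_entry_mx_norm1 m n (A : 'M[int]_(m, n)) i j :
  (`|A i j| <= mx_norm1 A)%N.
Proof.
by rewrite /mx_norm1 (bigD1 i) //= (bigD1 j) //= -addnA leq_addr.
Qed.

Lemma mx_norm1_mul m n p (A : 'M[int]_(m, n)) (B : 'M[int]_(n, p)) :
  (mx_norm1 (A *m B) <= mx_norm1 A * mx_norm1 B)%N.
Proof.
rewrite /mx_norm1 big_distrl /=; apply: leq_sum => i _.
apply: (@leq_trans (\sum_j \sum_k `|A i k| * `|B k j|)%N).
  apply: leq_sum => j _; rewrite mxE; apply: leq_trans (leq_absz_sum _ _ _) _.
  by apply: leq_sum => k _; rewrite abszM.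
rewrite exchange_big big_distrl /=; apply: leq_sum => k _.
by rewrite -big_distrr leq_mul2l [X in _ || (_ <= X)%N](bigD1 k) //= leq_addr orbT.
Qed.

Lemma mx_norm1_expM n (A : 'M[int]_n) p (B : 'M[int]_(n, p)) k :
  (mx_norm1 (A ^+ k *m B) <= mx_norm1 A ^ k * mx_norm1 B)%N.
Proof.
elim: k => [|k IHk]; first by rewrite expr0 mul1mx mul1n.
rewrite exprS expnS -mulmxE -mulmxA -mulnA.
by apply: leq_trans (mx_norm1_mul _ _) _; rewrite leq_mul2l IHk orbT.
Qed.

Lemma root_char_poly_norm1 (C : numFieldType) n (A : 'M[int]_n) (z : C) :
  root (char_poly (map_mx intr A)) z -> `|z| <= (mx_norm1 A)%:R.
Proof.
rewrite -eigenvalue_root_char => /eigenvalueP[v vA v0].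
pose s := \sum_j `|v 0 j|.
have s_gt0 : 0 < s.
  rewrite lt_def sumr_ge0 ?andbT => [|j _]; last exact: normr_ge0.
  apply: contra_neq v0 => s0; apply/rowP => j; rewrite mxE.
  have /psumr_eq0P/(_ s0)/(_ j isT)/eqP : forall j, true -> 0 <= `|v 0 j| by [].
  by rewrite normr_eq0 => /eqP.
rewrite -(ler_pM2r s_gt0) /s mulr_sumr.
apply: (@le_trans _ _ (\sum_j \sum_i `|v 0 i| * `|A i j|%N%:R)).
  apply: ler_sum => j _.
  have -> : `|z| * `|v 0 j| = `|\sum_i v 0 i * (A i j)%:~R|.
    rewrite -normrM; congr `|_|; move/rowP/(_ j): vA; rewrite !mxE => <-.
    by apply: eq_bigr => i _; rewrite mxE.
  apply: le_trans (ler_norm_sum _ _ _) _; apply: ler_sum => i _.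
  by rewrite normrM natr_absz intr_norm.
rewrite exchange_big /= /s mulr_sumr; apply: ler_sum => i _.
rewrite -mulr_sumr mulrC ler_wpM2r ?normr_ge0 // -natr_sum ler_nat.
by rewrite /mx_norm1 [leqRHS](bigD1 i) //= leq_addr.
Qed.

Lemma root_char_poly_pow_norm1 (C : numFieldType) n (A : 'M[int]_n) (z : C) k a :
  root (char_poly (map_mx intr A)) z -> z ^+ k = a%:R -> (a <= mx_norm1 A ^ k)%N.
Proof.
move=> /root_char_poly_norm1 zA zk.
rewrite -(ler_nat C) natrX -[a%:R]normr_nat -zk normrX.
by rewrite lerXn2r ?nnegrE ?normr_ge0 ?ler0n.
Qed.

Lemma horner_mx_uniq_roots (F : fieldType) n (A : 'M[F]_n.+1) (rs : seq F)
    (p : {poly F}) :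
  char_poly A = \prod_(z <- rs) ('X - z%:P) -> uniq rs -> all (root p) rs ->
  horner_mx A p = 0.
Proof.
move=> chA uniq_rs root_rs.
have [q ->] : exists q, p = q * char_poly A.
  rewrite chA; apply: uniq_roots_prod_XsubC => //; by rewrite uniq_rootsE.
by rewrite rmorphM /= Cayley_Hamilton mulr0.
Qed.

Lemma exp_mx_two_values (C : numFieldType) n (A : 'M[int]_n.+1) (rs : seq C)
    k (a b : int) :
  char_poly (map_mx intr A) = \prod_(z <- rs) ('X - z%:P) -> uniq rs ->
  {in rs, forall z, z ^+ k = a%:~R \/ z ^+ k = b%:~R} ->
  (A ^+ k - a%:M) *m (A ^+ k - b%:M) = 0.
Proof.
move=> chA uniq_rs powE; pose p : {poly int} := ('X^k - a%:P) * ('X^k - b%:P).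
have <- : horner_mx A p = (A ^+ k - a%:M) *m (A ^+ k - b%:M).
  by rewrite rmorphM !rmorphB !rmorphXn /= horner_mx_X !horner_mx_C.
have intr_mx_inj : injective (map_mx (intr : int -> C) : 'M_n.+1 -> 'M_n.+1).
  move=> X Y /matrixP XY; apply/matrixP => i j.
  by apply: (@intr_inj C); move: (XY i j); rewrite !mxE.
apply: intr_mx_inj; rewrite map_horner_mx map_mx0.
apply: horner_mx_uniq_roots chA uniq_rs _; apply/allP => z /powE zk.
rewrite rmorphM !rmorphB /= map_polyXn !map_polyC /= /root !hornerE.
by case: zk => ->; rewrite subrr ?mul0r ?mulr0.
Qed.

Lemma exp_conj_pair_mx_two_values (C : numClosedFieldType) (A : 'M[int]_3)
    (lam rho : C) k j :
  char_poly (map_mx intr A) = \prod_(z <- [:: lam; lam^*; rho]) ('X - z%:P) ->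
  lam \isn't Num.real -> rho \is Num.real ->
  (0 < k)%N -> lam ^+ k = lam^* ^+ k -> (24 %| j)%N ->
  exists a b : nat, [/\ (b < a)%N, (a <= mx_norm1 A ^ j)%N
    & (A ^+ j - a%:Z%:M) *m (A ^+ j - b%:Z%:M) = 0].
Proof.
move=> chA lam_nonreal rho_real k_gt0 lam_pow dvd_j.
have splitA : map_poly intr (char_poly A) =
    \prod_(z <- [:: lam; lam^*; rho]) ('X - z%:P) by rewrite map_char_poly.
have [a [b [lamE lamJE rhoE]]] := conj_pair_cubic_pow_dvd24 lam_nonreal rho_real
  (char_poly_monic A) splitA k_gt0 lam_pow dvd_j.
have normE z c : z \in [:: lam; lam^*; rho] -> z ^+ j = c%:R ->
    (c <= mx_norm1 A ^ j)%N.
  move=> z_root; apply: root_char_poly_pow_norm1.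
  by rewrite chA root_prod_XsubC.
have aA : (a <= mx_norm1 A ^ j)%N by apply: normE lamE; rewrite inE eqxx.
have bA : (b <= mx_norm1 A ^ j)%N by apply: normE rhoE; rewrite !inE eqxx !orbT.
have annihil (c d : nat) : ((a == c) || (a == d)) && ((b == c) || (b == d)) ->
    (A ^+ j - c%:Z%:M) *m (A ^+ j - d%:Z%:M) = 0.
  move=> cd; apply: exp_mx_two_values chA (uniq_conj_pair_real _ _) _ => // z.
  rewrite !inE; case/andP: cd => acd bcd.
  case/or3P => /eqP ->; rewrite ?lamE ?lamJE ?rhoE.
  - by case/orP: acd => /eqP ->; [left | right].
  - by case/orP: acd => /eqP ->; [left | right].
  - by case/orP: bcd => /eqP ->; [left | right].
have [ab|ba|ab] := ltngtP a b.
- by exists b, a; split=> //; apply: annihil; rewrite !eqxx orbT.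
- by exists a, b; split=> //; apply: annihil; rewrite !eqxx orbT.
(* Both values agree: 0 serves as the second one, as it is not attained. *)
exists a, 0%N; split=> //; last by apply: annihil; rewrite -ab eqxx.
rewrite lt0n -(pnatr_eq0 C) -lamE expf_neq0 //.
by apply: contraNneq lam_nonreal => ->.
Qed.

Lemma comp_char_poly_scale (R : comNzRingType) n (c : R) (A : 'M[R]_n) :
  char_poly (c *: A) \Po (c *: 'X) = c ^+ n *: char_poly A.
Proof.
rewrite /char_poly -det_map_mx -[RHS]mul_polyC rmorphXn /= -detZ; congr (\det _).
apply/matrixP => i j; rewrite !mxE rmorphB rmorphMn /= comp_polyX comp_polyC.
by rewrite mulrBr mulrnAr -mul_polyC rmorphM.
Qed.

Lemma char_poly_scale (F : fieldType) n (c : F) (A : 'M[F]_n) (rs : seq F) :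
  c != 0 -> char_poly A = \prod_(z <- rs) ('X - z%:P) ->
  char_poly (c *: A) = \prod_(z <- [seq c * z | z <- rs]) ('X - z%:P).
Proof.
move=> c0 chA; rewrite big_map.
have cancel_comp (p : {poly F}) : (p \Po (c *: 'X)) \Po (c^-1 *: 'X) = p.
  by rewrite -comp_polyA comp_polyZ comp_polyX scalerA divff // scale1r comp_polyXr.
have size_rs : size rs = n.
  by apply: succn_inj; rewrite -(size_prod_XsubC _ id) -chA size_char_poly.
rewrite -[LHS]cancel_comp comp_char_poly_scale chA -[RHS]cancel_comp.
congr (_ \Po _); rewrite rmorph_prod -size_rs /=.
elim: rs {chA size_rs} => [|z rs IHrs]; first by rewrite !big_nil scale1r.
rewrite !big_cons exprS -scalerA scalerAr IHrs scalerAl; congr (_ * _).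
by rewrite comp_polyB comp_polyX comp_polyC scalerBr polyCM mul_polyC.
Qed.

(** * Exponential sums *)

Definition expsum (H S : nat) (G : nat -> int) : Prop :=
  exists l : seq (int * nat),
    [/\ all (fun t => t.2 <= H)%N l, (\sum_(t <- l) `|t.1| <= S)%N
      & forall m, G m = \sum_(t <- l) t.1 * t.2%:Z ^+ m].

Lemma expsum_ext H S G G' : G =1 G' -> expsum H S G -> expsum H S G'.
Proof. by move=> GG' [l [lH lS GE]]; exists l; split=> // m; rewrite -GG' GE. Qed.

Lemma expsum_weaken H S H' S' G :
  (H <= H')%N -> (S <= S')%N -> expsum H S G -> expsum H' S' G.
Proof.
move=> HH' SS' [l [lH lS GE]]; exists l; split=> //; last exact: leq_trans lS _.
by apply: sub_all lH => t /leq_trans; apply.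
Qed.

Lemma expsum_geometric (c : int) (h : nat) :
  expsum h `|c| (fun m => c * h%:Z ^+ m).
Proof. by exists [:: (c, h)]; split=> [||m]; rewrite ?big_seq1 //= leqnn. Qed.

Lemma expsum_const (c : int) : expsum 1 `|c| (fun=> c).
Proof.
by apply: expsum_ext (expsum_geometric c 1) => m; rewrite expr1n mulr1.
Qed.

Lemma expsumD H S S' G G' : expsum H S G -> expsum H S' G' ->
  expsum H (S + S') (fun m => G m + G' m).
Proof.
move=> [l [lH lS GE]] [l' [lH' lS' GE']]; exists (l ++ l'); split.
- by rewrite all_cat lH.
- by rewrite big_cat leq_add.
- by move=> m; rewrite big_cat GE GE'.
Qed.

Lemma expsum_sum (I : eqType) (r : seq I) H (S : I -> nat) (G : I -> nat -> int) :
  {in r, forall i, expsum H (S i) (G i)} ->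
  expsum H (\sum_(i <- r) S i) (fun m => \sum_(i <- r) G i m).
Proof.
elim: r => [|i r IHr] GS; first by exists [::]; split=> [||m]; rewrite ?big_nil.
have GSr : {in r, forall j, expsum H (S j) (G j)}.
  by move=> j jr; apply: GS; rewrite inE jr orbT.
rewrite big_cons; apply: expsum_ext (expsumD (GS i (mem_head _ _)) (IHr GSr)) => m.
by rewrite big_cons.
Qed.

Lemma expsumM H S H' S' G G' : expsum H S G -> expsum H' S' G' ->
  expsum (H * H') (S * S') (fun m => G m * G' m).
Proof.
move=> [l [lH lS GE]] [l' [lH' lS' GE']].
exists [seq (t.1 * t'.1, (t.2 * t'.2)%N) | t <- l, t' <- l']; split.
- apply/allP => _ /allpairsP[[t t'] [tl tl' ->]] /=.
  by rewrite leq_mul ?(allP lH) ?(allP lH').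
- rewrite big_allpairs_dep /=; apply: leq_trans (leq_mul lS lS').
  rewrite big_distrl /=; apply: leq_sum => t _; rewrite big_distrr /=.
  by apply: leq_sum => t' _; rewrite abszM.
- move=> m; rewrite GE GE' big_allpairs_dep /= mulr_suml; apply: eq_bigr => t _.
  rewrite mulr_sumr; apply: eq_bigr => t' _.
  by rewrite PoszM exprMn mulrACA.
Qed.

Lemma expsumX H S G k : expsum H S G ->
  expsum (H ^ k) (S ^ k) (fun m => G m ^+ k).
Proof.
move=> GS; elim: k => [|k IHk]; first exact: (expsum_const 1).
by rewrite !expnS; apply: expsum_ext (expsumM GS IHk) => m; rewrite exprS.
Qed.

Lemma expsum_prodX (I : Type) (r : seq I) H S (G : I -> nat -> int) (e : I -> nat) :
  (forall i, expsum H S (G i)) ->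
  expsum (H ^ \sum_(i <- r) e i) (S ^ \sum_(i <- r) e i)
    (fun m => \prod_(i <- r) G i m ^+ e i).
Proof.
move=> GS; elim: r => [|i r IHr].
  rewrite !big_nil; apply: expsum_ext (expsum_const 1) => m; by rewrite big_nil.
rewrite !big_cons !expnD.
apply: expsum_ext (expsumM (expsumX (e i) (GS i)) IHr) => m.
by rewrite big_cons.
Qed.

Lemma bernoulli_nat y m : (y ^ m.+1 + m.+1 * y ^ m <= y.+1 ^ m.+1)%N.
Proof.
elim: m => [|m IHm]; first by rewrite !expn0 !expn1 muln1 addn1.
rewrite (expnS y.+1); apply: leq_trans (leq_mul (leqnn y.+1) IHm).
by rewrite !(expnS y); move: (y ^ m)%N => z; nia.
Qed.

Lemma ltn_mul_exp_succ S y m : (S * y < m)%N -> (S * y ^ m < y.+1 ^ m)%N.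
Proof.
case: m => // m; case: y => [|y] ySm; first by rewrite exp0n // muln0 exp1n.
apply: leq_trans (bernoulli_nat y.+1 m).
rewrite expnS mulnA -addn1 addnC leq_add ?muln_gt0 ?expn_gt0 //.
by rewrite leq_mul2r ltnW ?orbT.
Qed.

Lemma sgr_addr_absz (x y : int) : (`|x| < `|y|)%N -> Num.sg (x + y) = Num.sg y.
Proof.
case: (ltrgt0P y) => [y0|y0|->] xy.
- by rewrite !gtr0_sg //; lia.
- by rewrite !ltr0_sg //; lia.
- by rewrite absz0 ltn0 in xy.
Qed.

Section SignOfExponentialSum.

Variables (c : nat -> int) (S : nat).

Lemma sgr_dominant_base n m :
  c n.+1 != 0 -> (\sum_(h < n.+1) `|c h| <= S)%N -> (S * n < m)%N ->
  Num.sg (\sum_(h < n.+2) c h * h%:Z ^+ m) = Num.sg (c n.+1).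
Proof.
move=> c0 cS Snm; rewrite big_ord_recr /= sgr_addr_absz.
  by rewrite sgrM [X in _ * X]gtr0_sg ?mulr1 // exprn_gt0.
apply: leq_ltn_trans (leq_absz_sum _ _ _) _.
apply: (@leq_ltn_trans (S * n ^ m)).
  apply: (@leq_trans (\sum_(h < n.+1) `|c h| * n ^ m)); last first.
    by rewrite -big_distrl leq_mul2r cS orbT.
  apply: leq_sum => h _; rewrite abszM abszX /= leq_mul2l.
  by rewrite leq_wexp2r ?orbT // -ltnS.
rewrite abszM abszX /=; apply: leq_trans (ltn_mul_exp_succ Snm) _.
by rewrite leq_pmull // lt0n absz_eq0.
Qed.

Lemma sgr_expsum_nat_const n : (\sum_(h < n.+1) `|c h| <= S)%N ->
  exists e : int, forall m, (n * S < m)%N ->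
    Num.sg (\sum_(h < n.+1) c h * h%:Z ^+ m) = e.
Proof.
elim: n => [|n IHn] cS.
  exists 0 => m m0; rewrite big_ord_recr big_ord0 /= add0r.
  by rewrite expr0n gtn_eqF // mulr0 sgr0.
rewrite big_ord_recr /= in cS.
have {}cS : (\sum_(h < n.+1) `|c h| <= S)%N.
  by apply: leq_trans cS; rewrite leq_addr.
have nS m : (n.+1 * S < m)%N -> (n * S < m)%N.
  by apply: leq_ltn_trans; rewrite leq_mul2r leqnSn orbT.
have [c0|c0] := eqVneq (c n.+1) 0.
  have [e eE] := IHn cS; exists e => m /nS/eE <-.
  by rewrite big_ord_recr /= c0 mul0r addr0.
by exists (Num.sg (c n.+1)) => m /nS Snm; rewrite sgr_dominant_base // mulnC.
Qed.

End SignOfExponentialSum.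

Lemma expsum_sgr_const H S G : expsum H S G ->
  exists e : int, forall m, (H * S < m)%N -> Num.sg (G m) = e.
Proof.
move=> [l [lH lS GE]].
pose c h := \sum_(t <- l | t.2 == h) t.1.
have partition_base (T : nmodType) (F : int * nat -> T) :
    \sum_(t <- l) F t = \sum_(h < H.+1) \sum_(t <- l | t.2 == h) F t.
  rewrite (exchange_big_dep xpredT) //= big_seq [RHS]big_seq.
  apply: eq_bigr => t /(allP lH); rewrite -ltnS => tH.
  by rewrite (big_pred1 (Ordinal tH)) // => h; rewrite /= eq_sym.
have [|e eE] := @sgr_expsum_nat_const c S H.
  apply: leq_trans lS; rewrite [leqRHS](partition_base nat).
  by apply: leq_sum => h _; apply: leq_absz_sum.
exists e => m /eE <-; congr Num.sg; rewrite GE partition_base.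
apply: eq_bigr => h _.
by rewrite mulr_suml; apply: eq_bigr => t /eqP ->.
Qed.

(** * Homogenized evaluation along an orbit *)

Definition mpoly_norm1 n (p : {mpoly int[n]}) : nat :=
  (\sum_(m <- msupp p) `|p@_m|)%N.

(* The denominators of u / q are cleared by q ^ (deg p + 1). *)
Definition hom_eval n (p : {mpoly int[n]}) (u : 'cV[int]_n) (q : int) : int :=
  \sum_(m <- msupp p) p@_m * (\prod_i u i 0 ^+ m i * q ^+ (msize p - mdeg m)).

Lemma prodrX_mnm_scale (R : comPzRingType) n (m : 'X_{1..n}) (c : R)
    (x : 'I_n -> R) :
  \prod_i (c * x i) ^+ m i = c ^+ mdeg m * \prod_i x i ^+ m i.
Proof.
rewrite mdegE -prodrXr -big_split; apply: eq_bigr => i _; exact: exprMn.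
Qed.

Lemma hom_evalE (F : numFieldType) n (p : {mpoly int[n]}) (u : 'cV[int]_n)
    (q : int) :
  q != 0 ->
  (hom_eval p u q)%:~R = q%:~R ^+ msize p *
    (map_mpoly intr p).@[fun i => ((q%:~R : F)^-1 *: map_mx intr u) i 0].
Proof.
move=> q0; have q0' : (q%:~R : F) != 0 by rewrite intr_eq0.
rewrite mevalE (perm_big _ (msupp_map_mpoly _ (@intr_inj F))) /=.
rewrite rmorph_sum mulr_sumr big_seq [RHS]big_seq; apply: eq_bigr => m mp.
rewrite mcoeff_map_mpoly /=; under [X in _ = _ * (_ * X)]eq_bigr do rewrite !mxE.
rewrite prodrX_mnm_scale rmorphM rmorphM rmorph_prod rmorphXn /=.
under eq_bigr do rewrite rmorphXn.
rewrite [RHS]mulrCA; congr (_ * _); rewrite [RHS]mulrA mulrC; congr (_ * _).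
by rewrite exprVn expfB_cond ?(negPf q0') // add0n ltnW ?msize_mdeg_lt.
Qed.

Lemma hom_eval_scale n (p : {mpoly int[n]}) (u : 'cV[int]_n) (q c : int) :
  hom_eval p (c *: u) (c * q) = c ^+ msize p * hom_eval p u q.
Proof.
rewrite /hom_eval mulr_sumr big_seq [RHS]big_seq; apply: eq_bigr => m mp.
under eq_bigr do rewrite mxE.
rewrite prodrX_mnm_scale exprMn -[in RHS](subnKC (ltnW (msize_mdeg_lt mp))) exprD.
by rewrite addKn [in LHS]mulrACA [LHS]mulrCA.
Qed.

Lemma expsum_hom_eval n (p : {mpoly int[n]}) H S (u : nat -> 'cV[int]_n)
    (q : nat -> int) :
  (forall i, expsum H S (fun m => u m i 0)) -> expsum H S q ->
  expsum (H ^ msize p) (mpoly_norm1 p * S ^ msize p)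
    (fun m => hom_eval p (u m) (q m)).
Proof.
move=> uS qS; rewrite /mpoly_norm1 big_distrl; apply: expsum_sum => m mp.
rewrite -[(H ^ _)%N]mul1n -(subnKC (ltnW (msize_mdeg_lt mp))) !expnD.
apply: expsumM; first exact: expsum_const.
rewrite addKn; apply: expsumM; last exact: expsumX.
by have := expsum_prodX (index_enum _) m uS; rewrite -mdegE.
Qed.

Lemma exp_mx_two_values_interpolation (R : comNzRingType) n (B : 'M[R]_n)
    (a b : R) m :
  (B - a%:M) *m (B - b%:M) = 0 ->
  (a - b) *: B ^+ m = a ^+ m *: (B - b%:M) - b ^+ m *: (B - a%:M).
Proof.
move=> Bab.
have Bba : (B - b%:M) *m (B - a%:M) = 0.
  rewrite -Bab !mulmxBl !mulmxBr !mul_scalar_mx !mul_mx_scalar.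
  rewrite !scale_scalar_mx (mulrC a b) !opprB addrACA [RHS]addrACA.
  by congr (_ + _); rewrite addrC.
have eigenE x y : (B - x%:M) *m (B - y%:M) = 0 -> B *m (B - y%:M) = x *: (B - y%:M).
  by rewrite mulmxBl mul_scalar_mx => /eqP; rewrite subr_eq0 => /eqP.
elim: m => [|m IHm].
  by rewrite !expr0 !scale1r opprB [RHS]addrC addrA subrK scalemx1 raddfB.
rewrite !exprS -mulmxE scalemxAr IHm mulmxBr -!scalemxAr (eigenE _ _ Bab).
by rewrite (eigenE _ _ Bba) !scalerA ![_ ^+ m * _]mulrC.
Qed.

Section OrbitBounds.

Variables (n : nat) (A : 'M[int]_n) (v : 'cV[int]_n) (a b K Y r : nat).

Hypothesis (Y_gt3 : (3 < Y)%N).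
Hypotheses (AY : (mx_norm1 A <= Y)%N) (vY : (mx_norm1 v <= Y)%N).
Hypotheses (rK : (r < K)%N) (ba : (b < a)%N) (aY : (a <= Y ^ K)%N).
Hypothesis (Aab : (A ^+ K - a%:Z%:M) *m (A ^+ K - b%:Z%:M) = 0).

Lemma leq_orbit_entry k i : (`|(A ^+ k *m v) i 0%R| <= Y ^ k.+1)%N.
Proof.
apply: leq_trans (leq_entry_mx_norm1 _ _ _) _.
apply: leq_trans (mx_norm1_expM _ _ _) _; rewrite expnSr.
by apply: leq_mul => //; apply: leq_wexp2r.
Qed.

Lemma leq_shifted_orbit_entry (c : nat) i : (c <= Y ^ K)%N ->
  (`|((A ^+ K - c%:Z%:M) *m (A ^+ r *m v)) i 0%R| <= 2 * Y ^ (2 * K))%N.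
Proof.
move=> cY; have leY k : (k <= 2 * K)%N -> (Y ^ k <= Y ^ (2 * K))%N.
  by move=> kK; rewrite leq_pexp2l //; lia.
rewrite mulmxBl mul_scalar_mx mxE mul2n -addnn.
apply: leq_trans (leq_abszD _ _) _; apply: leq_add.
  rewrite mulmxA mulmxE -exprD; apply: leq_trans (leq_orbit_entry _ _) _.
  by apply: leY; lia.
rewrite mxE abszN mxE abszM /= mul2n -addnn expnD leq_mul //.
by apply: leq_trans (leq_orbit_entry _ _) _; rewrite leq_pexp2l //; lia.
Qed.

Lemma expsum_orbit i :
  expsum (Y ^ K) (Y ^ (2 * K + 1))
    (fun m => (a - b)%N%:Z * (A ^+ (K * m + r) *m v) i 0).
Proof.
pose shifted (c : nat) := (A ^+ K - c%:Z%:M) *m (A ^+ r *m v).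
apply: (@expsum_ext _ _
    (fun m => shifted b i 0 * a%:Z ^+ m + - shifted a i 0 * b%:Z ^+ m)).
  move=> m; rewrite -subzn ?(ltnW ba) // exprD exprM -mulmxE -mulmxA.
  transitivity ((((a%:Z - b%:Z) *: (A ^+ K) ^+ m) *m (A ^+ r *m v)) i 0).
    rewrite (exp_mx_two_values_interpolation _ Aab) mulmxBl -!scalemxAl.
    have entryE (x y : 'cV[int]_n) c d :
        (c *: x - d *: y) i 0 = c * x i 0 - d * y i 0.
      by rewrite !mxE.
    by rewrite entryE mulNr !(mulrC (_ ^+ m)).
  by rewrite -scalemxAl [LHS]mxE.
have bY : (b <= Y ^ K)%N := leq_trans (ltnW ba) aY.
apply: (@expsum_weaken (Y ^ K) (2 * Y ^ (2 * K) + 2 * Y ^ (2 * K))) => //.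
  by rewrite -mulnDl expnD expn1 mulnC leq_mul2l Y_gt3 orbT.
by apply: expsumD; apply: expsum_weaken (expsum_geometric _ _) => //;
  rewrite ?abszN; apply: leq_shifted_orbit_entry.
Qed.

Lemma hom_eval_orbit_sgr_const (p : {mpoly int[n]}) (D E : nat) :
  (D <= Y)%N -> (E <= Y)%N ->
  exists e : int, forall m,
    ((Y ^ K) ^ msize p * (mpoly_norm1 p * (Y ^ (2 * K + 1)) ^ msize p) < m)%N ->
    Num.sg (hom_eval p (A ^+ (K * m + r) *m v) (D ^ (K * m + r) * E)%N%:Z) = e.
Proof.
move=> DY EY; pose k := (a - b)%N.
pose u m := k%:Z *: (A ^+ (K * m + r) *m v).
pose q m : int := k%:Z * (D ^ (K * m + r) * E)%N%:Z.
have uS i : expsum (Y ^ K) (Y ^ (2 * K + 1)) (fun m => u m i 0).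
  by apply: expsum_ext (expsum_orbit i) => m; rewrite [RHS]mxE.
have qS : expsum (Y ^ K) (Y ^ (2 * K + 1)) q.
  apply: (@expsum_ext _ _ (fun m => (k * (D ^ r * E))%N%:Z * (D ^ K)%N%:Z ^+ m)).
    by move=> m; rewrite /q expnD expnM -!natz -natrX -!natrM; congr _%:R; ring.
  apply: expsum_weaken (expsum_geometric _ _) => /=; first exact: leq_wexp2r.
  rewrite (_ : 2 * K + 1 = K + K.+1)%N; last by lia.
  rewrite expnD leq_mul ?(leq_trans (leq_subr _ _)) //.
  apply: (@leq_trans (Y ^ r * Y)); first by rewrite leq_mul ?leq_wexp2r.
  by rewrite -expnSr leq_pexp2l //; lia.
have [e eE] := expsum_sgr_const (expsum_hom_eval p uS qS).
exists e => m /eE <-; rewrite /u /q hom_eval_scale sgrM.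
have -> : Num.sg (k%:Z ^+ msize p) = 1.
  by apply/gtr0_sg/exprn_gt0; rewrite ltz_nat subn_gt0.
by rewrite mul1r.
Qed.

End OrbitBounds.

(** * Bit lengths *)

Definition mx_den m n (M : 'M[rat]_(m, n)) : nat :=
  (\prod_ij `|denq (M ij.1 ij.2)|)%N.

Definition mx_num m n (M : 'M[rat]_(m, n)) : 'M[int]_(m, n) :=
  \matrix_(i, j) (numq (M i j) *
    (\prod_(kl | kl != (i, j)) `|denq (M kl.1 kl.2)|)%N%:Z).

Lemma mx_den_gt0 m n (M : 'M[rat]_(m, n)) : (0 < mx_den M)%N.
Proof. by rewrite prodn_gt0 // => ij; rewrite absz_gt0 denq_neq0. Qed.

Lemma mx_numE (F : numFieldType) m n (M : 'M[rat]_(m, n)) :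
  map_mx intr (mx_num M) = (mx_den M)%:R *: map_mx ratr M :> 'M[F]_(m, n).
Proof.
apply/matrixP => i j; rewrite !mxE /mx_den [X in X%:R](bigD1 (i, j)) //=.
rewrite intrM natrM -pmulrn mulrAC; congr (_ * _).
by rewrite natr_absz normr_denq mulrC /ratr mulfVK // intr_eq0 denq_neq0.
Qed.

Lemma absz_lt_int_bits (z : int) : (`|z| < 2 ^ int_bits z)%N.
Proof.
apply: leq_trans (trunc_log_ltn _ (isT : 1 < 2)%N) _.
by rewrite /int_bits leq_exp2l // leq_addl.
Qed.

Lemma leq_absz_numq_bits (x : rat) : (`|numq x| <= 2 ^ rat_bits x)%N.
Proof.
by apply: leq_trans (ltnW (absz_lt_int_bits _)) _; rewrite leq_exp2l // leq_addr.
Qed.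

Lemma leq_absz_denq_bits (x : rat) : (`|denq x| <= 2 ^ rat_bits x)%N.
Proof.
by apply: leq_trans (ltnW (absz_lt_int_bits _)) _; rewrite leq_exp2l // leq_addl.
Qed.

Lemma mx_bitsE m n (M : 'M[rat]_(m, n)) :
  mx_bits M = (\sum_ij rat_bits (M ij.1 ij.2))%N.
Proof. by rewrite /mx_bits pair_big. Qed.

Lemma leq_mx_den_bits m n (M : 'M[rat]_(m, n)) : (mx_den M <= 2 ^ mx_bits M)%N.
Proof.
by rewrite mx_bitsE expn_sum; apply: leq_prod => ij _; apply: leq_absz_denq_bits.
Qed.

Lemma leq_mx_num_norm1_bits m n (M : 'M[rat]_(m, n)) :
  (mx_norm1 (mx_num M) <= m * n * 2 ^ mx_bits M)%N.
Proof.
apply: (@leq_trans (\sum_(i < m) \sum_(j < n) 2 ^ mx_bits M)%N); last first.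
  by rewrite !sum_nat_const !card_ord mulnA.
apply: leq_sum => i _; apply: leq_sum => j _.
rewrite mxE abszM mx_bitsE expn_sum [leqRHS](bigD1 (i, j)) //=.
apply: leq_mul; first exact: leq_absz_numq_bits.
by apply: leq_prod => ij _; apply: leq_absz_denq_bits.
Qed.

Lemma leq_size_mx_bits m n (M : 'M[rat]_(m, n)) : (m * n * 4 <= mx_bits M)%N.
Proof.
apply: (@leq_trans (\sum_(i < m) \sum_(j < n) 4)%N).
  by rewrite !sum_nat_const !card_ord mulnA.
by do 2!(apply: leq_sum => ? _); apply: (@leq_add 2 2).
Qed.

Lemma sum_absz_lt_bits (l : seq int) :
  (\sum_(z <- l) `|z| < 2 ^ \sum_(z <- l) int_bits z)%N.
Proof.
elim: l => [|z l IHl]; first by rewrite !big_nil.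
rewrite !big_cons expnD; move: (absz_lt_int_bits z) IHl; nia.
Qed.

Definition triples (d : nat) : seq (nat * nat * nat) :=
  [seq (ij, k) | ij <- [seq (i, j) | i <- iota 0 d, j <- iota 0 (d - i)],
                 k <- iota 0 (d - ij.1 - ij.2)].

Definition mnm3 (x : nat * nat * nat) : 'X_{1..3} :=
  [multinom [tuple x.1.1; x.1.2; x.2]].

Lemma coef_listE p : coef_list p = [seq p@_(mnm3 x) | x <- triples (msize p)].
Proof. by []. Qed.

Lemma mnm3E x : ((mnm3 x 0 = x.1.1) * (mnm3 x 1 = x.1.2) * (mnm3 x 2 = x.2))%type.
Proof. by []. Qed.

Lemma forall_ord3 (P : 'I_3 -> Prop) : P 0 -> P 1 -> P 2 -> forall i, P i.
Proof.
by move=> P0 P1 P2 [[|[|[|i]]] lti] //; [move: P0 | move: P1 | move: P2];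
  congr P; apply: val_inj.
Qed.

Lemma big_ord3 (T : Type) (idx : T) (op : Monoid.law idx) (F : 'I_3 -> T) :
  \big[op/idx]_i F i = op (F 0) (op (F 1) (F 2)).
Proof.
rewrite !big_ord_recl big_ord0 Monoid.mulm1.
by congr (op (F _) (op (F _) (F _))); apply: val_inj.
Qed.

Lemma mnm3_inj : injective mnm3.
Proof.
move=> [[i j] k] [[i' j'] k'] /mnmP eq_mnm.
by move: (eq_mnm 0) (eq_mnm 1) (eq_mnm 2); rewrite !mnm3E /= => -> -> ->.
Qed.

Lemma mnm3_surj (m : 'X_{1..3}) : m = mnm3 (m 0, m 1, m 2).
Proof. by apply/mnmP; apply: forall_ord3; rewrite !mnm3E. Qed.

Lemma mdeg_mnm3 x : mdeg (mnm3 x) = (x.1.1 + x.1.2 + x.2)%N.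
Proof. by rewrite mdegE big_ord3 /= !mnm3E addnA. Qed.

Lemma mem_triples d x : (x \in triples d) = (mdeg (mnm3 x) < d)%N.
Proof.
rewrite mdeg_mnm3; case: x => [[i j] k] /=; apply/allpairsPdep/idP => /=.
  move=> [[i' j']] [k'] [/allpairsPdep[i1 [j1 []]]].
  rewrite !mem_iota /= => ? ? [-> ->] ? [-> -> ->]; lia.
move=> ijk; exists (i, j), k; split=> //; last by rewrite mem_iota /=; lia.
by apply/allpairsPdep; exists i, j; rewrite !mem_iota; split=> //=; lia.
Qed.

Lemma uniq_triples d : uniq (triples d).
Proof.
apply: allpairs_uniq_dep => [|ij _|[ij k] [ij' k'] _ _ /= [-> ->]] //.
- apply: allpairs_uniq_dep => [|i _|[i j] [i' j'] _ _ /= [-> ->]] //;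
  exact: iota_uniq.
- exact: iota_uniq.
Qed.

Lemma sum_msupp_triples (V : nmodType) (R : nzRingType) (p : {mpoly R[3]})
    (F : 'X_{1..3} -> V) :
  (forall m, m \notin msupp p -> F m = 0) ->
  \sum_(m <- msupp p) F m = \sum_(x <- triples (msize p)) F (mnm3 x).
Proof.
move=> F0.
rewrite -(big_map mnm3 xpredT F) [RHS](bigID (mem (msupp p))) /=.
rewrite [X in _ = _ + X]big1 ?addr0 => [|m /F0] //.
rewrite -[RHS]big_filter; apply: perm_big; apply: uniq_perm => [||m].
- exact: msupp_uniq.
- by rewrite filter_uniq // map_inj_uniq ?uniq_triples //; apply: mnm3_inj.
rewrite mem_filter; case: (boolP (m \in msupp p)) => //= mp; apply/esym.
by rewrite [m]mnm3_surj map_f // mem_triples -mnm3_surj msize_mdeg_lt.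
Qed.

Lemma mpoly_norm1_coef_list p : mpoly_norm1 p = (\sum_(z <- coef_list p) `|z|)%N.
Proof.
rewrite coef_listE big_map /mpoly_norm1 (sum_msupp_triples (V := nat)) // => m.
by move=> /memN_msupp_eq0 ->.
Qed.

Lemma leq_mpoly_norm1_bits p : (mpoly_norm1 p <= 2 ^ poly_bits p)%N.
Proof. by rewrite mpoly_norm1_coef_list ltnW ?sum_absz_lt_bits. Qed.

Lemma leq_msize_bits p : (msize p <= poly_bits p)%N.
Proof.
apply: (@leq_trans (size (coef_list p))); last first.
  by rewrite -sum1_size /poly_bits; apply: leq_sum.
rewrite coef_listE size_map -[leqLHS](size_iota 0).
rewrite -(size_map (fun i => (i, 0, 0)%N)); apply: uniq_leq_size.
  by rewrite map_inj_uniq ?iota_uniq // => i j [].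
move=> _ /mapP [i + ->]; rewrite mem_iota add0n => id.
by rewrite mem_triples mdeg_mnm3 /= !addn0.
Qed.

(** * Rational orbits *)

Definition orbit_num n (M : 'M[rat]_n) (s : 'cV[rat]_n) k : 'cV[int]_n :=
  mx_num M ^+ k *m mx_num s.

Definition orbit_den n (M : 'M[rat]_n) (s : 'cV[rat]_n) k : nat :=
  (mx_den M ^ k * mx_den s)%N.

Definition orbit_eval n (p : {mpoly int[n]}) (M : 'M[rat]_n) (s : 'cV[rat]_n) k :
    int :=
  hom_eval p (orbit_num M s k) (orbit_den M s k).

Lemma orbit_den_gt0 n (M : 'M[rat]_n) s k : (0 < orbit_den M s k)%N.
Proof. by rewrite muln_gt0 expn_gt0 !mx_den_gt0. Qed.

Lemma orbitE (F : numFieldType) n (M : 'M[rat]_n.+1) (s : 'cV[rat]_n.+1) k :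
  map_mx ratr (M ^+ k *m s) =
    (orbit_den M s k)%:R^-1 *: map_mx intr (orbit_num M s k) :> 'cV[F]_n.+1.
Proof.
rewrite map_mxM rmorphXn [map_mx intr _]map_mxM rmorphXn /= !mx_numE exprZn.
rewrite -scalemxAl -scalemxAr !scalerA natrM natrX -mulrA mulVf ?scale1r //.
by rewrite mulf_neq0 ?expf_neq0 // pnatr_eq0 -lt0n mx_den_gt0.
Qed.

Definition sign_holds (sim : sign_cond) (z : int) : bool :=
  match sim with SGt => 0 < z | SGe => 0 <= z end.

Lemma sign_holds_sg sim z : sign_holds sim (Num.sg z) = sign_holds sim z.
Proof. by case: sim; rewrite /= ?sgr_gt0 ?sgr_ge0. Qed.

Lemma target_orbit (R : realType) (M : 'M[rat]_3) (s : 'cV[rat]_3) p sim k :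
  (map_mx ratr (M ^+ k *m s) \in target R p sim) =
  sign_holds sim (orbit_eval p M s k).
Proof.
have q0 : (orbit_den M s k)%:Z != 0 by rewrite eqz_nat -lt0n orbit_den_gt0.
have := hom_evalE R p (orbit_num M s k) q0.
rewrite -[hom_eval _ _ _]/(orbit_eval p M s k) -pmulrn -orbitE.
rewrite -[_.@[_]]/(mpeval p (map_mx ratr (M ^+ k *m s))).
set y := map_mx ratr _; set h := orbit_eval _ _ _ _ => hE.
have q0' : 0 < ((orbit_den M s k)%:R : R) ^+ msize p.
  by rewrite exprn_gt0 // ltr0n orbit_den_gt0.
rewrite inE; case: sim => /=.
  by rewrite -(pmulr_rgt0 _ q0') -hE ltr0z.
by rewrite -(pmulr_rge0 _ q0') -hE ler0z.
Qed.

Lemma leq_threshold_exp2 (L d S : nat) :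
  (36 <= L)%N -> (d <= L)%N -> (S <= 2 ^ L)%N ->
  (((2 ^ (2 * L)) ^ 288) ^ d * (S * ((2 ^ (2 * L)) ^ (2 * 288 + 1)) ^ d)
    <= 2 ^ L ^ 5)%N.
Proof.
move=> L36 dL SL.
apply: (@leq_trans (2 ^ (2 * L * 288 * d) *
  (2 ^ L * 2 ^ (2 * L * (2 * 288 + 1) * d)))%N).
  by apply: leq_mul; [|apply: leq_mul => //]; rewrite -!expnM ?mulnA.
rewrite -!expnD leq_exp2l //.
apply: (@leq_trans (36 ^ 3 * L ^ 2)); last first.
  by rewrite (expnD L 3 2) leq_mul2r leq_exp2r // L36 orbT.
by clear -dL; rewrite -(mulnn L); nia.
Qed.

Section InstanceBounds.

Variables (M : 'M[rat]_3) (s : 'cV[rat]_3) (p : {mpoly int[3]}).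

Local Notation L := (instance_bits M s p).
Local Notation Y := (2 ^ (2 * L))%N.

Lemma leq36_instance_bits : (36 <= L)%N.
Proof. by have := leq_size_mx_bits M; rewrite /instance_bits; lia. Qed.

Lemma leq_instance_exp2 n x : (n <= L)%N -> (x <= 9 * 2 ^ n)%N -> (x <= Y)%N.
Proof.
have L36 := leq36_instance_bits.
move=> nL /leq_trans; apply; apply: (@leq_trans (2 ^ 4 * 2 ^ L)).
  by apply: leq_mul => //; rewrite leq_exp2l.
by rewrite -expnD leq_exp2l //; lia.
Qed.

Lemma instance_mx_bounds :
  [/\ (mx_norm1 (mx_num M) <= Y)%N, (mx_norm1 (mx_num s) <= Y)%N,
      (mx_den M <= Y)%N & (mx_den s <= Y)%N].
Proof.
have [ML sL] : (mx_bits M <= L)%N /\ (mx_bits s <= L)%N.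
  by rewrite /instance_bits; lia.
split; [apply: leq_instance_exp2 ML _|apply: leq_instance_exp2 sL _|
  apply: leq_instance_exp2 ML _|apply: leq_instance_exp2 sL _].
- exact: leq_mx_num_norm1_bits.
- by apply: leq_trans (leq_mx_num_norm1_bits _) _; rewrite leq_mul2r orbT.
- by apply: leq_trans (leq_mx_den_bits _) _; rewrite leq_pmull.
- by apply: leq_trans (leq_mx_den_bits _) _; rewrite leq_pmull.
Qed.

Lemma orbit_eval_sgr_const (a b r : nat) :
  (r < 288)%N -> (b < a)%N -> (a <= mx_norm1 (mx_num M) ^ 288)%N ->
  (mx_num M ^+ 288 - a%:Z%:M) *m (mx_num M ^+ 288 - b%:Z%:M) = 0 ->
  exists e : int, forall m, (2 ^ L ^ 5 < m)%N ->
    Num.sg (orbit_eval p M s (288 * m + r)) = e.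
Proof.
move=> rK ba aA Aab; have L36 := leq36_instance_bits.
have [MY sY DY EY] := instance_mx_bounds.
have Y_gt3 : (3 < Y)%N by rewrite -[4%N]/(2 ^ 2)%N leq_exp2l //; lia.
have [dL pL] : (msize p <= L)%N /\ (mpoly_norm1 p <= 2 ^ L)%N.
  have pL : (poly_bits p <= L)%N by rewrite /instance_bits -addnA leq_addr.
  split; first exact: leq_trans (leq_msize_bits p) pL.
  by apply: leq_trans (leq_mpoly_norm1_bits p) _; rewrite leq_exp2l.
have threshold := leq_threshold_exp2 L36 dL pL.
move: (288)%N rK aA Aab threshold => K rK aA Aab threshold.
have aY := leq_trans aA (leq_wexp2r K MY).
have [e eE] := hom_eval_orbit_sgr_const Y_gt3 MY sY rK ba aY Aab p DY EY.
by exists e => m /(leq_ltn_trans threshold)/eE.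
Qed.

End InstanceBounds.

(** * Computable functions *)

(* A value of type E is passed to a recursive function as a list of naturals of
   fixed length; a fixed length is what lets [RComp] rebuild the whole list. *)
Record environment (E : Type) := Environment {
  env_args :> E -> seq nat;
  env_arity : nat;
  size_env : forall x, size (env_args x) = env_arity }.

Definition computable E (env : environment E) (f : E -> nat) : Prop :=
  exists F, forall x, computes F (env x) (f x).

Lemma size_env_cons E T (enc : T -> nat) (env : environment E) (y : T * E) :
  size (enc y.1 :: env y.2) = (env_arity env).+1.
Proof. by rewrite /= size_env. Qed.

Definition env_cons E T (enc : T -> nat) (env : environment E) :
  environment (T * E) := Environment (@size_env_cons E T enc env).

Lemma computes_comp F gs v ws y :
  size gs = size ws ->
  (forall i, (i < size gs)%N -> computes (nth RZero gs i) v (nth 0%N ws i)) ->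
  computes F ws y -> computes (RComp F gs) v y.
Proof.
move=> gw gsP Fy; exists ws; split=> //.
elim: gs ws {Fy} gw gsP => [|g gs IHgs] [|w ws] //= [gw] gsP.
split; first exact: (gsP 0%N).
by apply: IHgs => // i igs; apply: (gsP i.+1).
Qed.

Lemma computable_ext E (env : environment E) f g :
  f =1 g -> computable env f -> computable env g.
Proof. by move=> fg [F FP]; exists F => x; rewrite -fg. Qed.

Lemma computable_arg E (env : environment E) i :
  computable env (fun x => nth 0%N (env x) i).
Proof. by exists (RProj i). Qed.

Lemma computable_subst E E' (env : environment E) (env' : environment E')
    (h : E -> E') f :
  (forall i, computable env (fun x => nth 0%N (env' (h x)) i)) ->
  computable env' f -> computable env (fun x => f (h x)).
Proof.
move=> hP [F FP].
have argP (i : 'I_(env_arity env')) : exists G,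
    forall x, computes G (env x) (nth 0%N (env' (h x)) i) by apply: hP.
have [G GP] := fin_all_exists argP.
exists (RComp F (codom G)) => x; apply: computes_comp (FP (h x)).
  by rewrite size_codom card_ord size_env.
move=> i; rewrite size_codom card_ord => ik.
rewrite (nth_map (Ordinal ik)) ?size_enum_ord //.
by rewrite (nth_ord_enum _ (Ordinal ik)); apply: GP.
Qed.

Section EnvironmentVariables.

Variables (E T U : Type) (env : environment E) (enc : T -> nat) (encU : U -> nat).

Lemma computable_weaken f :
  computable env f -> computable (env_cons enc env) (fun y => f y.2).
Proof.
apply: computable_subst => i.
exact: (computable_arg (env_cons enc env) i.+1).
Qed.

Lemma computable_var0 : computable (env_cons enc env) (fun y => enc y.1).
Proof. exact: (computable_arg (env_cons enc env) 0). Qed.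

Lemma computable_var1 :
  computable (env_cons encU (env_cons enc env)) (fun y => enc y.2.1).
Proof. exact: (computable_arg (env_cons encU (env_cons enc env)) 1). Qed.

Lemma computable_var2 V (encV : V -> nat) :
  computable (env_cons encV (env_cons encU (env_cons enc env)))
    (fun y => enc y.2.2.1).
Proof.
exact: (computable_arg (env_cons encV (env_cons encU (env_cons enc env))) 2).
Qed.

Lemma computable_weaken2 f : computable env f ->
  computable (env_cons encU (env_cons enc env)) (fun y => f y.2.2).
Proof.
apply: computable_subst => i.
exact: (computable_arg (env_cons encU (env_cons enc env)) i.+2).
Qed.

Lemma computable_weaken3 V (encV : V -> nat) f : computable env f ->
  computable (env_cons encV (env_cons encU (env_cons enc env)))
    (fun y => f y.2.2.2).
Proof.
apply: computable_subst => i.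
exact: (computable_arg (env_cons encV (env_cons encU (env_cons enc env))) i.+3).
Qed.

Lemma computable_weaken_under f : computable (env_cons encU env) f ->
  computable (env_cons encU (env_cons enc env)) (fun y => f (y.1, y.2.2)).
Proof.
apply: (@computable_subst _ _ _ (env_cons encU env) (fun y => (y.1, y.2.2))) => -[|i].
  exact: (computable_arg (env_cons encU (env_cons enc env)) 0).
exact: (computable_arg (env_cons encU (env_cons enc env)) i.+2).
Qed.

Lemma computable_iteri (n : E -> nat) (t0 : E -> T) (g : nat -> T -> E -> T) :
  computable env n -> computable env (fun x => enc (t0 x)) ->
  computable (env_cons id (env_cons enc env))
    (fun y => enc (g y.1 y.2.1 y.2.2)) ->
  computable env (fun x => enc (iteri (n x) (fun i t => g i t x) (t0 x))).
Proof.
move=> [Fn FnP] [F0 F0P] [Fg FgP].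
exists (RComp (RPrec F0 Fg)
  (Fn :: [seq RProj i | i <- iota 0 (env_arity env)])) => x.
apply: (@computes_comp _ _ _ (n x :: env x)).
- by rewrite /= size_map size_iota size_env.
- move=> [_ //|i] /=.
  rewrite size_map size_iota ltnS => ik.
  by rewrite (nth_map 0%N) ?size_iota // nth_iota.
- exists (fun m => enc (iteri m (fun i t => g i t x) (t0 x))); split=> //=.
  by move=> i _; apply: (FgP (i, (iteri i (fun i t => g i t x) (t0 x), x))).
Qed.

End EnvironmentVariables.

Lemma computable_iteri_nat E (env : environment E) (n f : E -> nat)
    (g : nat -> nat -> E -> nat) :
  computable env n -> computable env f ->
  computable (env_cons id (env_cons id env)) (fun y => g y.1 y.2.1 y.2.2) ->
  computable env (fun x => iteri (n x) (fun i t => g i t x) (f x)).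
Proof. exact: (@computable_iteri _ nat env id). Qed.

Lemma computable_succ E (env : environment E) f :
  computable env f -> computable env (fun x => (f x).+1).
Proof.
move=> [F FP]; exists (RComp RSucc [:: F]) => x.
by apply: (@computes_comp _ _ _ [:: f x]) => // -[|] // _ /=.
Qed.

Lemma computable_const E (env : environment E) n : computable env (fun=> n).
Proof.
by elim: n => [|n IHn]; [exists RZero | apply: computable_succ].
Qed.

Lemma computable_pred E (env : environment E) f :
  computable env f -> computable env (fun x => (f x).-1).
Proof.
move=> cf; apply: (computable_ext (f := fun x => iteri (f x) (fun i _ => i) 0%N)).
  by move=> x; case: (f x).
apply: computable_iteri_nat => //; first exact: computable_const.
exact: computable_var0.
Qed.

Lemma computable_add E (env : environment E) f g :
  computable env f -> computable env g -> computable env (fun x => f x + g x)%N.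
Proof.
move=> cf cg.
apply: (computable_ext (f := fun x => iteri (f x) (fun _ t => t.+1) (g x))).
  by move=> x; elim: (f x) => //= n ->.
apply: computable_iteri_nat => //; apply: computable_succ; exact: computable_var1.
Qed.

Lemma computable_sub E (env : environment E) f g :
  computable env f -> computable env g -> computable env (fun x => f x - g x)%N.
Proof.
move=> cf cg.
apply: (computable_ext (f := fun x => iteri (g x) (fun _ t => t.-1) (f x))).
  by move=> x; elim: (g x) => /= [|n ->]; rewrite ?subn0 ?subnS.
apply: computable_iteri_nat => //; apply: computable_pred; exact: computable_var1.
Qed.

Definition computable_op T (enc : T -> nat) (op : T -> T -> T) : Prop :=
  forall E (env : environment E) f g,
  computable env (fun x => enc (f x)) -> computable env (fun x => enc (g x)) ->
  computable env (fun x => enc (op (f x) (g x))).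

Section ComputableBigop.

Variables (T : Type) (enc : T -> nat) (idx : T) (op : Monoid.law idx).

Hypothesis computable_opP : computable_op enc op.

Lemma computable_bigop_nat E (env : environment E) n (F : nat -> E -> T) :
  computable env n -> computable (env_cons id env) (fun y => enc (F y.1 y.2)) ->
  computable env (fun x => enc (\big[op/idx]_(0 <= i < n x) F i x)).
Proof.
move=> cn cF.
apply: (computable_ext (f := fun x =>
  enc (iteri (n x) (fun i t => op t (F i x)) idx))).
  move=> x; congr enc; elim: (n x) => [|m /= ->]; first by rewrite big_geq.
  by rewrite big_nat_recr.
apply: computable_iteri => //; first exact: computable_const.
apply: computable_opP; first exact: computable_var1.
exact: computable_weaken_under cF.
Qed.

Lemma computable_bigop_seq E (env : environment E) (I : Type) (r : seq I)
    (P : pred I) (F : I -> E -> T) :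
  (forall i, computable env (fun x => enc (F i x))) ->
  computable env (fun x => enc (\big[op/idx]_(i <- r | P i) F i x)).
Proof.
move=> cF; elim: r => [|i r IHr].
  by apply: computable_ext (computable_const env (enc idx)) => x; rewrite big_nil.
case Pi : (P i).
  by apply: computable_ext (computable_opP (cF i) IHr) => x; rewrite big_cons Pi.
by apply: computable_ext IHr => x; rewrite big_cons Pi.
Qed.

Lemma big_triples d (F : nat * nat * nat -> T) :
  \big[op/idx]_(t <- triples d) F t =
  \big[op/idx]_(0 <= i < d) \big[op/idx]_(0 <= j < d - i)
    \big[op/idx]_(0 <= k < d - i - j) F (i, j, k).
Proof.
rewrite !big_allpairs_dep /index_iota subn0; apply: eq_bigr => i _.
by rewrite subn0; apply: eq_bigr => j _; rewrite subn0.
Qed.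

Lemma computable_bigop_triples E (env : environment E) d
    (F : nat * nat * nat -> E -> T) :
  computable env d ->
  computable (env_cons id (env_cons id (env_cons id env)))
    (fun y => enc (F (y.2.2.1, y.2.1, y.1) y.2.2.2)) ->
  computable env (fun x => enc (\big[op/idx]_(t <- triples (d x)) F t x)).
Proof.
move=> cd cF.
apply: (computable_ext (f := fun x => enc (\big[op/idx]_(0 <= i < d x)
  \big[op/idx]_(0 <= j < d x - i)
    \big[op/idx]_(0 <= k < d x - i - j) F (i, j, k) x))).
  by move=> x; rewrite big_triples.
have cd1 : computable (env_cons id env) (fun y => d y.2 - y.1)%N.
  by apply: computable_sub; [apply: computable_weaken | apply: computable_var0].
do 2?[apply: computable_bigop_nat => //]; apply: computable_bigop_nat => //.
apply: computable_sub; first exact: (computable_weaken _ cd1).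
exact: computable_var0.
Qed.

End ComputableBigop.

Lemma computable_sum E (env : environment E) n (f : nat -> E -> nat) :
  computable env n -> computable (env_cons id env) (fun y => f y.1 y.2) ->
  computable env (fun x => \sum_(0 <= i < n x) f i x)%N.
Proof. exact: (computable_bigop_nat (enc := id) computable_add). Qed.

Lemma computable_mul E (env : environment E) f g :
  computable env f -> computable env g -> computable env (fun x => f x * g x)%N.
Proof.
move=> cf cg.
apply: (computable_ext (f := fun x => \sum_(0 <= i < f x) g x)%N).
  by move=> x; rewrite sum_nat_const_nat subn0.
by apply: computable_sum => //; apply: computable_weaken.
Qed.

Lemma computable_exp E (env : environment E) f g :
  computable env f -> computable env g -> computable env (fun x => f x ^ g x)%N.
Proof.
move=> cf cg.
apply: (computable_ext (f := fun x => iteri (g x) (fun _ t => f x * t)%N 1%N)).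
  by move=> x; elim: (g x) => //= n ->; rewrite expnS.
apply: computable_iteri_nat => //; first exact: computable_const.
apply: computable_mul; first exact: computable_weaken2.
exact: computable_var1.
Qed.

Lemma computable_leq E (env : environment E) f g :
  computable env f -> computable env g ->
  computable env (fun x => (f x <= g x)%N : nat).
Proof.
move=> cf cg; apply: (computable_ext (f := fun x => 1 - (f x - g x))%N).
  by move=> x; lia.
by apply: computable_sub; [apply: computable_const | apply: computable_sub].
Qed.

Lemma computable_eq E (env : environment E) f g :
  computable env f -> computable env g ->
  computable env (fun x => (f x == g x) : nat).
Proof.
move=> cf cg.
apply: (computable_ext (f := fun x => ((f x <= g x) * (g x <= f x))%N)).
  by move=> x; rewrite eqn_leq mulnb.
by apply: computable_mul; apply: computable_leq.
Qed.

Lemma computable_if E (env : environment E) (b : E -> bool) f g :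
  computable env (fun x => b x : nat) -> computable env f -> computable env g ->
  computable env (fun x => if b x then f x else g x).
Proof.
move=> cb cf cg.
apply: (computable_ext (f := fun x => b x * f x + (1 - b x) * g x)%N).
  by move=> x; case: (b x); rewrite ?mul1n ?mul0n ?addn0.
apply: computable_add; apply: computable_mul => //.
by apply: computable_sub => //; apply: computable_const.
Qed.

Lemma computable_odd E (env : environment E) f :
  computable env f -> computable env (fun x => odd (f x) : nat).
Proof.
move=> cf.
apply: (computable_ext (f := fun x => iteri (f x) (fun _ t => 1 - t)%N 0%N)).
  by move=> x; elim: (f x) => //= n ->; case: (odd n).
apply: computable_iteri_nat => //; first exact: computable_const.
by apply: computable_sub; [apply: computable_const | apply: computable_var1].
Qed.

Lemma computable_half E (env : environment E) f :
  computable env f -> computable env (fun x => (f x)./2).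
Proof.
move=> cf; apply: (computable_ext (f := fun x => \sum_(0 <= i < f x) odd i)%N).
  move=> x; elim: (f x) => [|n IHn]; first by rewrite big_geq.
  by rewrite big_nat_recr //= IHn uphalf_half addnC.
by apply: computable_sum => //; apply: computable_odd; apply: computable_var0.
Qed.

Lemma computable_double E (env : environment E) f :
  computable env f -> computable env (fun x => (f x).*2).
Proof.
move=> cf; apply: computable_ext (computable_add cf cf) => x; exact: addnn.
Qed.

Lemma trunc_log_sum b n : (1 < b)%N ->
  trunc_log b n = (\sum_(0 <= k < n) (b ^ k.+1 <= n))%N.
Proof.
move=> b1; have logn_lt : (trunc_log b n <= n)%N.
  case: n => [|n]; first by rewrite trunc_log0.
  by apply: ltnW; apply: leq_trans (ltn_expl _ b1) (trunc_logP _ _).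
rewrite (big_cat_nat _ logn_lt) //= [X in (_ + X)%N]big1_seq ?addn0.
  rewrite -[LHS]subn0 -[LHS]muln1 -sum_nat_const_nat; apply: eq_big_nat => k /= kn.
  have n0 : (0 < n)%N by apply: leq_trans logn_lt; apply: leq_ltn_trans kn.
  by rewrite (leq_trans _ (trunc_logP b1 n0)) // leq_exp2l.
move=> k; rewrite mem_index_iota /= => /andP[nk _].
by rewrite leqNgt (leq_trans (trunc_log_ltn _ b1)) // leq_exp2l.
Qed.

Lemma computable_trunc_log E (env : environment E) b f : (1 < b)%N ->
  computable env f -> computable env (fun x => trunc_log b (f x)).
Proof.
move=> b1 cf.
apply: (computable_ext (f := fun x => \sum_(0 <= k < f x) (b ^ k.+1 <= f x))%N).
  by move=> x; rewrite trunc_log_sum.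
apply: computable_sum => //; apply: computable_leq; last exact: computable_weaken.
by apply: computable_exp; [apply: computable_const
  | apply: computable_succ; apply: computable_var0].
Qed.

(* The pairing for which [CodeSeq.code (a :: s) = pair_code a (CodeSeq.code s)]. *)
Definition pair_code (a b : nat) : nat := (2 ^ a * b.*2.+1)%N.

Definition code_search (F : nat -> nat -> nat) (c : nat) : nat :=
  (\sum_(0 <= a < c) \sum_(0 <= b < c) F a b * (c == pair_code a b))%N.

Definition code_head : nat -> nat := code_search (fun a _ => a).

Definition code_behead : nat -> nat := code_search (fun _ b => b).

Lemma pair_code_inj a b a' b' :
  pair_code a b = pair_code a' b' -> a = a' /\ b = b'.
Proof.
rewrite -[b]CodeSeq.decodeK -[b']CodeSeq.decodeK.
by move=> eq_code; have [-> ->] := can_inj CodeSeq.codeK (eq_code :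
  CodeSeq.code (a :: CodeSeq.decode b) = CodeSeq.code (a' :: CodeSeq.decode b')).
Qed.

Lemma pair_code_gt a b : (a < pair_code a b)%N /\ (b < pair_code a b)%N.
Proof. by have := ltn_expl a (isT : 1 < 2)%N; rewrite /pair_code; nia. Qed.

Lemma code_search_pair F a b : code_search F (pair_code a b) = F a b.
Proof.
have [lt_a lt_b] := pair_code_gt a b.
have pick_term c (G : nat -> nat) : (c < pair_code a b)%N ->
    (forall i, i != c -> G i = 0%N) -> (\sum_(0 <= i < pair_code a b) G i = G c)%N.
  move=> lt_c G0; rewrite (bigD1_seq c) ?mem_index_iota ?iota_uniq //=.
  by rewrite big1 ?addn0.
rewrite /code_search (pick_term a) // => [|a' na].
  rewrite (pick_term b) ?eqxx ?muln1 // => b' nb.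
  by case: eqP => [/pair_code_inj[_ bb]|]; rewrite ?muln0 // bb eqxx in nb *.
apply: big1 => b' _; case: eqP => [/pair_code_inj[aa _]|]; last by rewrite muln0.
by rewrite aa eqxx in na.
Qed.

Lemma code_headE s : code_head (CodeSeq.code s) = head 0%N s.
Proof.
case: s => [|a s]; last exact: code_search_pair.
by rewrite /code_head /code_search big_geq.
Qed.

Lemma code_beheadE s : code_behead (CodeSeq.code s) = CodeSeq.code (behead s).
Proof.
case: s => [|a s]; last exact: code_search_pair.
by rewrite /code_behead /code_search big_geq.
Qed.

Lemma nth_code s i :
  nth 0%N s i = code_head (iteri i (fun _ => code_behead) (CodeSeq.code s)).
Proof.
have -> : iteri i (fun _ => code_behead) (CodeSeq.code s) = CodeSeq.code (drop i s).
  elim: i => [|i /= ->]; first by rewrite drop0.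
  by rewrite code_beheadE -drop1 drop_drop.
by rewrite code_headE -nth0 nth_drop addn0.
Qed.

Lemma computable_pair_code E (env : environment E) f g :
  computable env f -> computable env g ->
  computable env (fun x => pair_code (f x) (g x)).
Proof.
move=> cf cg; apply: computable_mul.
  by apply: computable_exp => //; apply: computable_const.
by apply: computable_succ; apply: computable_double.
Qed.

Lemma computable_code_search E (env : environment E) F f :
  computable (env_cons id (env_cons id env)) (fun y => F y.2.1 y.1) ->
  computable env f -> computable env (fun x => code_search F (f x)).
Proof.
move=> cF cf; apply: computable_sum => //.
apply: computable_sum; first exact: computable_weaken.
apply: computable_mul => //; apply: computable_eq; first exact: computable_weaken2.
by apply: computable_pair_code; [apply: computable_var1 | apply: computable_var0].
Qed.

Lemma computable_code_nth E (env : environment E) (s : E -> seq nat) i :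
  computable env (fun x => CodeSeq.code (s x)) -> computable env i ->
  computable env (fun x => nth 0%N (s x) (i x)).
Proof.
move=> cs ci; apply: (computable_ext (f := fun x =>
  code_head (iteri (i x) (fun _ => code_behead) (CodeSeq.code (s x))))).
  by move=> x; rewrite nth_code.
apply: computable_code_search; first exact: computable_var1.
apply: computable_iteri_nat => //.
by apply: computable_code_search; [apply: computable_var0 | apply: computable_var1].
Qed.

Lemma computable_code_map E (env : environment E) (I : Type) (r : seq I)
    (f : I -> E -> nat) :
  (forall i, computable env (f i)) ->
  computable env (fun x => CodeSeq.code [seq f i x | i <- r]).
Proof.
move=> cf; elim: r => [|i r IHr]; first exact: computable_const.
exact: computable_pair_code.
Qed.

Definition zcomputable E (env : environment E) (f : E -> int) : Prop :=
  computable env (fun x => int_code (f x)).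

Definition int_decode (n : nat) : int := if odd n then Negz n./2 else Posz n./2.

Definition int_pos (z : int) : nat := if z is Posz n then n else 0%N.

Definition int_neg (z : int) : nat := if z is Negz n then n.+1 else 0%N.

Lemma int_codeK : cancel int_code int_decode.
Proof.
by case=> n; rewrite /int_decode /= odd_double /= ?uphalf_double ?doubleK.
Qed.

Lemma int_decodeK : cancel int_decode int_code.
Proof.
by move=> n; rewrite /int_decode -{4}(odd_double_half n); case: odd.
Qed.

Lemma int_pos_neg z : z = (int_pos z)%:Z - (int_neg z)%:Z.
Proof. by case: z => n /=; rewrite ?subr0 // NegzE sub0r. Qed.

Lemma zcomputable_ext E (env : environment E) f g :
  f =1 g -> zcomputable env f -> zcomputable env g.
Proof. by move=> fg; apply: computable_ext => x; rewrite fg. Qed.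

Lemma computable_int_pos E (env : environment E) f :
  zcomputable env f -> computable env (fun x => int_pos (f x)).
Proof.
move=> cf; apply: (computable_ext (f := fun x =>
  if odd (int_code (f x)) then 0%N else (int_code (f x))./2)).
  by move=> x; case: (f x) => n /=; rewrite odd_double ?doubleK.
by apply: computable_if; [apply: computable_odd | apply: computable_const
  | apply: computable_half].
Qed.

Lemma computable_int_neg E (env : environment E) f :
  zcomputable env f -> computable env (fun x => int_neg (f x)).
Proof.
move=> cf; apply: (computable_ext (f := fun x =>
  if odd (int_code (f x)) then (int_code (f x))./2.+1 else 0%N)).
  by move=> x; case: (f x) => n /=; rewrite odd_double //= uphalf_double.
by apply: computable_if; [apply: computable_odd
  | apply: computable_succ; apply: computable_half | apply: computable_const].
Qed.

Lemma computable_absz E (env : environment E) f :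
  zcomputable env f -> computable env (fun x => `|f x|%N).
Proof.
move=> cf; apply: (computable_ext (f := fun x => int_pos (f x) + int_neg (f x))%N).
  by move=> x; case: (f x) => n //=; rewrite addn0.
by apply: computable_add; [apply: computable_int_pos | apply: computable_int_neg].
Qed.

Lemma zcomputable_subn E (env : environment E) f g :
  computable env f -> computable env g ->
  zcomputable env (fun x => (f x)%:Z - (g x)%:Z).
Proof.
move=> cf cg; apply: (computable_ext (f := fun x => if (g x <= f x)%N
  then (f x - g x).*2 else (g x - f x).-1.*2.+1)%N).
  move=> x; case: leqP => [gf|fg]; first by rewrite subzn.
  by have -> : (f x)%:Z - (g x)%:Z = Negz (g x - f x).-1 by lia.
apply: computable_if; first exact: computable_leq.
  by apply: computable_double; apply: computable_sub.
apply: computable_succ; apply: computable_double; apply: computable_pred.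
exact: computable_sub.
Qed.

Lemma zcomputable_nat E (env : environment E) f :
  computable env f -> zcomputable env (fun x => (f x)%:Z).
Proof. exact: computable_double. Qed.

Lemma zcomputable_decode E (env : environment E) f :
  computable env f -> zcomputable env (fun x => int_decode (f x)).
Proof. by apply: computable_ext => x; rewrite int_decodeK. Qed.

Lemma zcomputable_add E (env : environment E) f g :
  zcomputable env f -> zcomputable env g -> zcomputable env (fun x => f x + g x).
Proof.
move=> cf cg; apply: (zcomputable_ext (f := fun x =>
  (int_pos (f x) + int_pos (g x))%N%:Z - (int_neg (f x) + int_neg (g x))%N%:Z)).
  move=> x; rewrite [f x in RHS]int_pos_neg [g x in RHS]int_pos_neg !PoszD; ring.
by apply: zcomputable_subn; apply: computable_add;
  do [exact: computable_int_pos | exact: computable_int_neg].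
Qed.

Lemma zcomputable_mul E (env : environment E) f g :
  zcomputable env f -> zcomputable env g -> zcomputable env (fun x => f x * g x).
Proof.
move=> cf cg; apply: (zcomputable_ext (f := fun x =>
  (int_pos (f x) * int_pos (g x) + int_neg (f x) * int_neg (g x))%N%:Z
  - (int_pos (f x) * int_neg (g x) + int_neg (f x) * int_pos (g x))%N%:Z)).
  move=> x; rewrite [f x in RHS]int_pos_neg [g x in RHS]int_pos_neg.
  by rewrite !PoszD !PoszM; ring.
by apply: zcomputable_subn; apply: computable_add; apply: computable_mul;
  do [exact: computable_int_pos | exact: computable_int_neg].
Qed.

Lemma zcomputable_exp E (env : environment E) f g :
  zcomputable env f -> computable env g -> zcomputable env (fun x => f x ^+ g x).
Proof.
move=> cf cg; apply: (zcomputable_ext (f := fun x =>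
  iteri (g x) (fun _ t => f x * t) 1)).
  by move=> x; elim: (g x) => //= n ->; rewrite exprS.
apply: computable_iteri => //; first exact: computable_const.
apply: zcomputable_mul; first exact: (computable_weaken2 _ _ cf).
exact: computable_var1.
Qed.

Lemma computable_int_bits E (env : environment E) f :
  zcomputable env f -> computable env (fun x => int_bits (f x)).
Proof.
move=> cf; apply: computable_add; first exact: computable_const.
by apply: computable_succ; apply: computable_trunc_log => //; apply: computable_absz.
Qed.

Lemma computable_sign_holds E (env : environment E) f sim :
  zcomputable env f -> computable env (fun x => sign_holds sim (f x) : nat).
Proof.
move=> cf; case: sim => /=.
  apply: (computable_ext (f := fun x => (1 <= int_pos (f x))%N : nat)).
    by move=> x; case: (f x).
  by apply: computable_leq; [apply: computable_const | apply: computable_int_pos].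
apply: (computable_ext (f := fun x => (int_neg (f x) <= 0)%N : nat)).
  by move=> x; case: (f x).
by apply: computable_leq; [apply: computable_int_neg | apply: computable_const].
Qed.

Definition vec_code n (v : 'cV[int]_n) : nat :=
  CodeSeq.code [seq int_code (v i 0) | i <- enum 'I_n].

Lemma computable_vec_code E (env : environment E) n (v : E -> 'cV[int]_n) :
  computable env (fun x => vec_code (v x)) <->
  forall i, zcomputable env (fun x => v x i 0).
Proof.
split=> [cv i|cv]; last exact: computable_code_map.
apply: computable_ext (computable_code_nth cv (computable_const _ i)) => x.
by rewrite (nth_map i) ?size_enum_ord // nth_ord_enum.
Qed.

Lemma zcomputable_mx_orbit E (env : environment E) n (A : E -> 'M[int]_n)
    (v : E -> 'cV[int]_n) k :
  computable env k -> (forall i j, zcomputable env (fun x => A x i j)) ->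
  (forall i, zcomputable env (fun x => v x i 0)) ->
  forall i, zcomputable env (fun x => (A x ^+ k x *m v x) i 0).
Proof.
move=> ck cA /computable_vec_code cv; apply/computable_vec_code.
apply: (computable_ext (f := fun x =>
  vec_code (iteri (k x) (fun _ w => A x *m w) (v x)))).
  move=> x; congr vec_code.
  elim: (k x) => /= [|m ->]; first by rewrite expr0 mul1mx.
  by rewrite exprS -mulmxE mulmxA.
apply: computable_iteri => //; apply/computable_vec_code => i.
have cw : computable (env_cons id (env_cons (@vec_code n) env))
    (fun y => vec_code y.2.1).
  exact: computable_var1.
apply: (zcomputable_ext (f := fun y : nat * ('cV[int]_n * E) =>
  \sum_j A y.2.2 i j * y.2.1 j 0)).
  by move=> y; rewrite mxE.
apply: (computable_bigop_seq zcomputable_add) => j.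
apply: zcomputable_mul; first exact: (computable_weaken2 _ _ (cA i j)).
by move/computable_vec_code: cw; apply.
Qed.

Definition triple_index (d i j k : nat) : nat :=
  (\sum_(0 <= i' < i) \sum_(0 <= j' < d - i') (d - i' - j')
   + (\sum_(0 <= j' < j) (d - i - j') + k))%N.

Lemma nth_flatten_map_iota (T : Type) (x0 : T) (s : nat -> seq T) n i k :
  (i < n)%N -> (k < size (s i))%N ->
  let ss := [seq s i' | i' <- iota 0 n] in
  let pos := (\sum_(0 <= i' < i) size (s i') + k)%N in
  (pos < size (flatten ss))%N /\ nth x0 (flatten ss) pos = nth x0 (s i) k.
Proof.
move=> lt_in lt_k ss pos.
have nth_ss : nth [::] ss i = s i by rewrite (nth_map 0%N) ?size_iota ?nth_iota.
have k_shape : (k < nth 0 (shape ss) i)%N.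
  by rewrite (nth_map [::]) ?size_map ?size_iota ?nth_ss.
have -> : pos = flatten_index (shape ss) i k.
  congr (_ + _)%N; rewrite /shape -!map_take take_iota (minn_idPl (ltnW lt_in)).
  by rewrite sumnE !big_map /index_iota subn0.
rewrite size_flatten flatten_indexP // nth_flatten.
by rewrite flatten_indexKl // flatten_indexKr // nth_ss.
Qed.

Definition triples_row (d i : nat) : seq (nat * nat * nat) :=
  flatten [seq [seq (i, j, k) | k <- iota 0 (d - i - j)] | j <- iota 0 (d - i)].

Lemma triples_flatten d : triples d = flatten [seq triples_row d i | i <- iota 0 d].
Proof.
rewrite /triples; elim: (iota 0 d) => //= i s IHs.
by rewrite map_cat flatten_cat IHs -map_comp.
Qed.

Lemma size_triples_row d i :
  size (triples_row d i) = (\sum_(0 <= j < d - i) (d - i - j))%N.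
Proof.
rewrite size_flatten sumnE !big_map /index_iota subn0.
by apply: eq_bigr => j _; rewrite size_map size_iota.
Qed.

Lemma nth_triples x0 d i j k : (i + j + k < d)%N ->
  (triple_index d i j k < size (triples d))%N /\
  nth x0 (triples d) (triple_index d i j k) = (i, j, k).
Proof.
move=> ijk; pose col j' := [seq (i, j', k') | k' <- iota 0 (d - i - j')].
have col_size j' : size (col j') = (d - i - j')%N by rewrite size_map size_iota.
have [||lt_row nth_row] := @nth_flatten_map_iota _ x0 col (d - i) j k.
- by lia.
- by rewrite col_size; lia.
have -> : triple_index d i j k = (\sum_(0 <= i' < i) size (triples_row d i') +
    (\sum_(0 <= j' < j) size (col j') + k))%N.
  by congr (_ + (_ + _))%N; apply: eq_bigr => l _;
    rewrite ?size_triples_row ?col_size.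
have [||lt_triples nth_triples] := @nth_flatten_map_iota _ x0 (triples_row d) d i
  (\sum_(0 <= j' < j) size (col j') + k).
- by lia.
- exact: lt_row.
rewrite triples_flatten; split=> //.
by rewrite nth_triples nth_row (nth_map 0%N) ?nth_iota ?size_iota //; lia.
Qed.

Definition coef_lookup (d : nat) (cs : seq nat) (t : nat * nat * nat) : int :=
  int_decode (nth 0%N cs (triple_index d t.1.1 t.1.2 t.2)).

Definition coef_codes (p : {mpoly int[3]}) : seq nat :=
  [seq int_code z | z <- coef_list p].

Lemma coef_lookupE (p : {mpoly int[3]}) t : t \in triples (msize p) ->
  coef_lookup (msize p) (coef_codes p) t = p@_(mnm3 t).
Proof.
rewrite mem_triples mdeg_mnm3; case: t => [[i j] k] /= ijk.
have [lt_size nthE] := nth_triples (0, 0, 0)%N ijk.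
rewrite /coef_lookup /coef_codes coef_listE -map_comp /=.
rewrite (nth_map (0, 0, 0)%N) //= nthE.
exact: int_codeK.
Qed.

Lemma computable_triple_index E (env : environment E) (d i j k : E -> nat) :
  computable env d -> computable env i -> computable env j -> computable env k ->
  computable env (fun x => triple_index (d x) (i x) (j x) (k x)).
Proof.
move=> cd ci cj ck; have cd' := computable_weaken id cd.
have v0 := computable_var0 env id.
apply: computable_add; last apply: computable_add => //.
  apply: computable_sum => //; apply: computable_sum; first exact: computable_sub.
  apply: computable_sub; last exact: computable_var0.
  apply: (computable_weaken _ (f := fun y => d y.2 - y.1)%N).
  exact: computable_sub.
apply: computable_sum => //; apply: computable_sub => //.
by apply: computable_sub => //; apply: computable_weaken.
Qed.

Section ComputablePolynomial.

Variables (E : Type) (env : environment E) (p : E -> {mpoly int[3]}).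

Hypothesis computable_msize : computable env (fun x => msize (p x)).
Hypothesis computable_coef_list :
  computable env (fun x => CodeSeq.code (coef_codes (p x))).

Local Notation coef x := (coef_lookup (msize (p x)) (coef_codes (p x))).

Lemma zcomputable_coef :
  zcomputable (env_cons id (env_cons id (env_cons id env)))
    (fun y => coef y.2.2.2 (y.2.2.1, y.2.1, y.1)).
Proof.
apply: zcomputable_decode; apply: computable_code_nth.
  exact: (computable_weaken3 _ _ _ computable_coef_list).
apply: computable_triple_index.
- exact: (computable_weaken3 _ _ _ computable_msize).
- exact: computable_var2.
- exact: computable_var1.
- exact: computable_var0.
Qed.

Lemma computable_poly_bits : computable env (fun x => poly_bits (p x)).
Proof.
apply: (computable_ext (f := fun x =>
  (\sum_(t <- triples (msize (p x))) int_bits (coef x t))%N)).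
  move=> x; rewrite /poly_bits coef_listE big_map !big_seq.
  by apply: eq_bigr => t /coef_lookupE <-.
apply: (computable_bigop_triples (enc := id) computable_add computable_msize).
by apply: computable_int_bits; apply: zcomputable_coef.
Qed.

Lemma zcomputable_hom_eval (u : E -> 'cV[int]_3) (q : E -> int) :
  (forall i, zcomputable env (fun x => u x i 0)) -> zcomputable env q ->
  zcomputable env (fun x => hom_eval (p x) (u x) (q x)).
Proof.
move=> cu cq; pose monomial (x : E) (m : 'X_{1..3}) : int :=
  \prod_i u x i 0 ^+ m i * q x ^+ (msize (p x) - mdeg m).
apply: (zcomputable_ext (f := fun x =>
  \sum_(t <- triples (msize (p x))) coef x t * monomial x (mnm3 t))).
  move=> x; rewrite /hom_eval sum_msupp_triples => [|m /memN_msupp_eq0 -> //].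
    by rewrite !big_seq; apply: eq_bigr => t /coef_lookupE <-.
  by rewrite mul0r.
apply: (computable_bigop_triples zcomputable_add) => //.
set env3 := env_cons id _.
have weaken_triple f : computable env f -> computable env3 (fun y => f y.2.2.2).
  exact: computable_weaken3.
have cmnm i : computable env3 (fun y => mnm3 (y.2.2.1, y.2.1, y.1) i).
  by move: i; apply: forall_ord3;
    [apply: computable_var2 | apply: computable_var1 | apply: computable_var0].
apply: zcomputable_mul; first exact: zcomputable_coef.
apply: zcomputable_mul.
  apply: (computable_bigop_seq zcomputable_mul) => i.
  by apply: zcomputable_exp => //; apply: (weaken_triple _ (cu i)).
apply: zcomputable_exp; first exact: (weaken_triple _ cq).
apply: computable_sub; first exact: (weaken_triple _ computable_msize).
apply: (computable_ext (f := fun y => \sum_i mnm3 (y.2.2.1, y.2.1, y.1) i)%N).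
  by move=> y; rewrite mdegE.
exact: (computable_bigop_seq (enc := id) computable_add).
Qed.

End ComputablePolynomial.

Definition qcomputable E (env : environment E) (f : E -> rat) : Prop :=
  zcomputable env (fun x => numq (f x)) /\ zcomputable env (fun x => denq (f x)).

Section ComputableMatrix.

Variables (E : Type) (env : environment E) (m n : nat) (M : E -> 'M[rat]_(m, n)).

Hypothesis qcomputable_M : forall i j, qcomputable env (fun x => M x i j).

Lemma zcomputable_mx_num i j : zcomputable env (fun x => mx_num (M x) i j).
Proof.
apply: (zcomputable_ext (f := fun x => numq (M x i j) *
    (\prod_(kl | kl != (i, j)) `|denq (M x kl.1 kl.2)|)%N%:Z)).
  by move=> x; rewrite mxE.
apply: zcomputable_mul; first by case: (qcomputable_M i j).
apply: zcomputable_nat.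
apply: (computable_bigop_seq (enc := id) computable_mul) => kl.
by apply: computable_absz; case: (qcomputable_M kl.1 kl.2).
Qed.

Lemma computable_mx_den : computable env (fun x => mx_den (M x)).
Proof.
apply: (computable_bigop_seq (enc := id) computable_mul) => ij.
by apply: computable_absz; case: (qcomputable_M ij.1 ij.2).
Qed.

Lemma computable_mx_bits : computable env (fun x => mx_bits (M x)).
Proof.
apply: (computable_ext (f := fun x => \sum_ij rat_bits (M x ij.1 ij.2))%N).
  by move=> x; rewrite mx_bitsE.
apply: (computable_bigop_seq (enc := id) computable_add) => ij.
case: (qcomputable_M ij.1 ij.2) => cnum cden.
by apply: computable_add; apply: computable_int_bits.
Qed.

End ComputableMatrix.

Lemma computable_set_code E (env : environment E) n (X : E -> {set 'I_n}) :
  (forall i, computable env (fun x => i \in X x : nat)) ->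
  computable env (fun x => set_code (X x)).
Proof.
move=> cX; apply: (computable_ext (f := fun x => \sum_i (i \in X x) * 2 ^ i)%N).
  move=> x; rewrite /set_code [RHS]big_mkcond; apply: eq_bigr => i _.
  by case: (i \in X x); rewrite ?mul1n ?mul0n.
apply: (computable_bigop_seq (enc := id) computable_add) => i.
by apply: computable_mul => //; apply: computable_const.
Qed.

Definition mx_indices m n : seq ('I_m * 'I_n) :=
  [seq (i, j) | i <- enum 'I_m, j <- enum 'I_n].

Lemma mem_mx_indices m n (ij : 'I_m * 'I_n) : ij \in mx_indices m n.
Proof. by case: ij => i j; apply: allpairs_f; rewrite mem_enum. Qed.

Lemma size_mx_codes m n (M : 'M[rat]_(m, n)) :
  size (mx_codes M) = (size (mx_indices m n)).*2.
Proof.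
by rewrite /mx_codes -/(mx_indices m n); elim: (mx_indices m n) => //= ij l ->.
Qed.

Lemma nth_flatten_pairs (I : eqType) (T : Type) (x0 : T) (f g : I -> T)
    (l : seq I) (r : seq T) i :
  i \in l ->
  let s := flatten [seq [:: f j; g j] | j <- l] ++ r in
  nth x0 s (index i l).*2 = f i /\ nth x0 s (index i l).*2.+1 = g i.
Proof.
elim: l => //= j l IHl; rewrite inE eq_sym.
by case: eqVneq => [->|_] //= /IHl.
Qed.

Lemma nth_mx_codes m n (M : 'M[rat]_(m, n)) (r : seq nat) i j :
  let k := (index (i, j) (mx_indices m n)).*2 in
  nth 0%N (mx_codes M ++ r) k = int_code (numq (M i j)) /\
  nth 0%N (mx_codes M ++ r) k.+1 = int_code (denq (M i j)).
Proof. exact: (nth_flatten_pairs _ _ _ _ (mem_mx_indices (i, j))). Qed.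

Lemma nth_size_cat (T : Type) (x0 : T) (r s : seq T) i :
  nth x0 (r ++ s) (size r + i) = nth x0 s i.
Proof. by rewrite nth_cat ltnNge leq_addr addKn. Qed.

Record instance := Instance {
  inst_mx : 'M[rat]_3;
  inst_vec : 'cV[rat]_3;
  inst_poly : {mpoly int[3]} }.

Definition inst_codes (x : instance) : seq nat :=
  instance_codes (inst_mx x) (inst_vec x) (inst_poly x).

Definition inst_bits (x : instance) : nat :=
  instance_bits (inst_mx x) (inst_vec x) (inst_poly x).

Definition inst_eval (x : instance) : nat -> int :=
  orbit_eval (inst_poly x) (inst_mx x) (inst_vec x).

Lemma size_inst_codes x : size (inst_codes x) =
  ((size (mx_indices 3 3)).*2 + ((size (mx_indices 3 1)).*2 + 2))%N.
Proof. by rewrite /inst_codes /instance_codes !size_cat !size_mx_codes. Qed.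

Definition instance_env : environment instance := Environment size_inst_codes.

Lemma qcomputable_inst_mx i j : qcomputable instance_env (fun x => inst_mx x i j).
Proof.
pose k := (index (i, j) (mx_indices 3 3)).*2.
have codesE x := nth_mx_codes (inst_mx x) (mx_codes (inst_vec x) ++
  [:: msize (inst_poly x); CodeSeq.code (coef_codes (inst_poly x))]) i j.
split.
  by apply: computable_ext (computable_arg instance_env k) => x; case: (codesE x).
by apply: computable_ext (computable_arg instance_env k.+1) => x; case: (codesE x).
Qed.

Lemma qcomputable_inst_vec i j : qcomputable instance_env (fun x => inst_vec x i j).
Proof.
pose k0 := (size (mx_indices 3 3)).*2.
pose k := (index (i, j) (mx_indices 3 1)).*2.
have codesE x := nth_mx_codes (inst_vec x)
  [:: msize (inst_poly x); CodeSeq.code (coef_codes (inst_poly x))] i j.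
split; [apply: computable_ext (computable_arg instance_env (k0 + k)) |
        apply: computable_ext (computable_arg instance_env (k0 + k.+1))] => x;
  by case: (codesE x); rewrite /k0 -(size_mx_codes (inst_mx x)) nth_size_cat.
Qed.

Lemma computable_inst_poly :
  computable instance_env (fun x => msize (inst_poly x)) /\
  computable instance_env
    (fun x => CodeSeq.code (coef_codes (inst_poly x))).
Proof.
pose k := (size (mx_indices 3 3)).*2; pose l := (size (mx_indices 3 1)).*2.
split; [apply: computable_ext (computable_arg instance_env (k + (l + 0))) |
        apply: computable_ext (computable_arg instance_env (k + (l + 1)))] => x;
  by rewrite /k /l -(size_mx_codes (inst_mx x)) -(size_mx_codes (inst_vec x))
    !nth_size_cat.
Qed.

Lemma computable_inst_bits : computable instance_env inst_bits.
Proof.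
have [cmsize ccoefs] := computable_inst_poly.
apply: computable_add; last exact: computable_mx_bits qcomputable_inst_vec.
apply: computable_add; last exact: computable_mx_bits qcomputable_inst_mx.
exact: computable_poly_bits.
Qed.

Lemma zcomputable_inst_eval k :
  computable instance_env k -> zcomputable instance_env (fun x => inst_eval x (k x)).
Proof.
move=> ck; have [cmsize ccoefs] := computable_inst_poly.
apply: zcomputable_hom_eval => //.
  apply: zcomputable_mx_orbit => // [i j|i]; apply: zcomputable_mx_num.
    exact: qcomputable_inst_mx.
  exact: qcomputable_inst_vec.
apply: zcomputable_nat; apply: computable_mul.
  by apply: computable_exp => //; apply: computable_mx_den qcomputable_inst_mx.
exact: computable_mx_den qcomputable_inst_vec.
Qed.

Definition sign_threshold (x : instance) : nat := (2 ^ inst_bits x ^ 5)%N.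

Definition residue_set sim (x : instance) : {set 'I_288} :=
  [set r : 'I_288 | sign_holds sim (inst_eval x (288 * (sign_threshold x).+1 + r))].

Lemma computable_residue_set sim :
  computable instance_env (fun x => set_code (residue_set sim x)).
Proof.
have cconst := computable_const instance_env.
apply: computable_set_code => r; apply: (computable_ext (f := fun x =>
    sign_holds sim (inst_eval x (288 * (sign_threshold x).+1 + r)) : nat)).
  by move=> x; rewrite inE.
apply: computable_sign_holds; apply: zcomputable_inst_eval.
apply: computable_add => //; apply: computable_mul => //; apply: computable_succ.
apply: computable_exp => //; apply: computable_exp => //; exact: computable_inst_bits.
Qed.

Lemma leq_threshold_bits (x : instance) :
  (288 * (sign_threshold x).+1 <= 2 ^ inst_bits x ^ 6)%N.
Proof.
have L36 : (36 <= inst_bits x)%N := leq36_instance_bits _ _ _.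
rewrite /sign_threshold; move: (inst_bits x) L36 => L L36.
apply: (@leq_trans (2 ^ 9 * 2 ^ (L ^ 5).+1)).
  apply: leq_mul => //; rewrite (expnS 2 (L ^ 5)) mul2n -addnn -addn1 leq_add2l.
  by rewrite expn_gt0.
rewrite -expnD leq_exp2l // (expnS L 5).
have : (1 <= L ^ 5)%N by rewrite expn_gt0; lia.
by nia.
Qed.

(** * Residue classes modulo 288 *)

Local Open Scope complex_scope.

Lemma unity_root_conj_pow (C : numClosedFieldType) (z : C) :
  is_root_of_unity (z / `|z|) ->
  exists2 k, (0 < k)%N & z ^+ k = Num.conj z ^+ k.
Proof.
move=> [k k0 /unity_rootP zk]; exists k => //.
have zE : z ^+ k = `|z| ^+ k.
  have [->|z0] := eqVneq z 0; first by rewrite normr0.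
  by apply/divr1_eq; rewrite -expr_div_n.
by rewrite -rmorphXn zE /= rmorphXn /= conj_normC.
Qed.

Lemma mx_num_exp_two_values (R : realType) (M : 'M[rat]_3) (lam : R[i])
    (rho : R) j :
  char_poly (map_mx ratr M) =
    ('X - lam%:P) * ('X - (Num.conj lam)%:P) * ('X - (rho%:C)%:P) ->
  lam \isn't Num.real -> is_root_of_unity (lam / `|lam|) -> (24 %| j)%N ->
  exists a b : nat, [/\ (b < a)%N, (a <= mx_norm1 (mx_num M) ^ j)%N
    & (mx_num M ^+ j - a%:Z%:M) *m (mx_num M ^+ j - b%:Z%:M) = 0].
Proof.
move=> chM lamNR lam1; set D : R[i] := (mx_den M)%:R.
have [k k0 lamk] := unity_root_conj_pow lam1.
have D0 : D != 0 by rewrite pnatr_eq0 -lt0n mx_den_gt0.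
have DR : D \is Num.real by rewrite realn.
have conjD z : Num.conj (D * z) = D * Num.conj z by rewrite rmorphM /= conj_Creal.
apply: (@exp_conj_pair_mx_two_values _ _ (D * lam) (D * rho%:C) k) => //.
- rewrite mx_numE conjD.
  apply: (char_poly_scale (rs := [:: lam; Num.conj lam; rho%:C])) => //.
  by rewrite chM !big_cons big_nil mulr1 mulrA.
- by apply: contra lamNR => DlamR; rewrite -(mulKf D0 lam) rpredM // rpredV.
- by rewrite rpredM // complex_real.
- by rewrite conjD !exprMn lamk.
Qed.

Lemma target_mod288 (R : realType) (M : 'M[rat]_3) (s : 'cV[rat]_3)
    (p : {mpoly int[3]}) (lam : R[i]) (rho : R) sim n :
  char_poly (map_mx ratr M) =
    ('X - lam%:P) * ('X - (Num.conj lam)%:P) * ('X - (rho%:C)%:P) ->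
  lam \isn't Num.real -> is_root_of_unity (lam / `|lam|) ->
  let x := Instance M s p in
  (288 * (sign_threshold x).+1 < n)%N ->
  (map_mx ratr (M ^+ n *m s) \in target R p sim) =
    (inord (n %% 288) \in residue_set sim x).
Proof.
move=> chM lam_nonreal lam_unity x nN.
have r288 : (n %% 288 < 288)%N by rewrite ltn_mod.
have [|a [b [ba aA Aab]]] :=
    mx_num_exp_two_values (j := 288) chM lam_nonreal lam_unity.
  by [].
have [e eE] := orbit_eval_sgr_const s p r288 ba aA Aab.
have lt_quotient : (sign_threshold x < n %/ 288)%N.
  by rewrite leq_divRL // mulnC ltnW.
rewrite target_orbit inE inordK // -sign_holds_sg -[RHS]sign_holds_sg.
by rewrite eE // {1}(divn_eq n 288) (mulnC _ 288) eE.
Qed.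

Theorem theorem13 (R : realType) :
  exists c : nat, forall sim : sign_cond, exists F : recfun,
  forall (M : 'M[rat]_3) (s : 'cV[rat]_3) (p : {mpoly int[3]})
         (lam : R[i]) (rho : R),
    char_poly (map_mx ratr M) =
      ('X - lam%:P) * ('X - (Num.conj lam)%:P) * ('X - (rho%:C)%:P) ->
    lam \isn't Num.real ->
    is_root_of_unity (lam / `|lam|) ->
    exists (N : nat) (X : {set 'I_288}),
      [/\ (N <= 2 ^ (instance_bits M s p ^ c))%N,
          computes F (instance_codes M s p) (set_code X)
        & forall n : nat, (N < n)%N ->
            (map_mx ratr (M ^+ n *m s) \in target R p sim)
            <-> inord (n %% 288) \in X].
Proof.
exists 6%N => sim; have [F FP] := computable_residue_set sim.
exists F => M s p lam rho chM lam_nonreal lam_unity; pose x := Instance M s p.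
exists (288 * (sign_threshold x).+1)%N, (residue_set sim x); split.
- exact: (leq_threshold_bits x).
- exact: (FP x).
- by move=> n nN; rewrite (target_mod288 _ chM).
Qed.
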